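(* Let $k,m,n\ge1$ be integers, let $J\in\mathbb{C}^{m\times m}$ satisfy $J=J^*=J^{-1}$, and let $\beta:[a,b]\to\mathbb{C}^{k\times m}$ be continuous with $$H(x)=\beta(x)^*\beta(x),\qquad \beta(x)J\beta(x)^*\equiv0,\qquad \sup_{a\le t<x\le b}\big\|(x-t)^{-1}\beta(x)J\beta(t)^*\big\|\le M$$ for some $M>0$. Let $B\in\mathbb{C}^{n\times n}$ with $\sigma(B)\cap[a,b]=\emptyset$, put $A(x)=(B-xI_n)^{-1}$, let $S(a)=S(a)^*\in\mathbb{C}^{n\times n}$ and $\Pi(a)\in\mathbb{C}^{n\times m}$ satisfy $A(a)S(a)-S(a)A(a)^*=\mathrm{i}\Pi(a)J\Pi(a)^*$, and let $\Pi(x),S(x)$ be the solutions on $[a,b]$, with these values at $a$, of $$\Pi_x=-\mathrm{i}A\Pi JH,\qquad S_x=\Pi JHJ^*\Pi^*-(AS+SA^* ).$$ Assume that $S(x)$ is invertible for every $x\in[a,b]$, and put $$w_0(x)=I_m-\mathrm{i}J\Pi(x)^*S(x)^{-1}A(x)^{-1}\Pi(x),\qquad \widetilde\beta(x)=\beta(x)w_0(x),\qquad \widetilde H(x)=w_0(x)^*H(x)w_0(x).$$ Then $\widetilde\beta$ is continuous on $[a,b]$, $$\widetilde H(x)=\widetilde\beta(x)^*\widetilde\beta(x),\qquad \widetilde\beta(x)J\widetilde\beta(x)^*\equiv0,$$ and there is $\widetilde M>0$ such that $$\sup_{a\le t<x\le b}\big\|(x-t)^{-1}\widetilde\beta(x)J\widetilde\beta(t)^*\big\|\le\widetilde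 M.$$ Moreover, for $$\widetilde W(x,z)=\overset{x}{\overset{\curvearrowleft}{\underset{a}{\int}}}\mathrm{e}^{\frac{\mathrm{i}J}{z-t}\widetilde H(t)\,dt}$$ the limit $$\widetilde V(x,s)=\lim_{\eta\to+0}\big(\widetilde W(x,s+\mathrm{i}\eta)-\widetilde W(x,s-\mathrm{i}\eta)\big)$$ exists for all $a\le s\le x\le b$, and $\|\widetilde V(x,s)\|$ is uniformly bounded on $a\le s\le x\le b$.
   Context: Here $*$ is the conjugate transpose, $\sigma(B)$ is the spectrum of $B$, and the subscript $x$ is $d/dx$. Multiplicative integral: for integrable $H$ on $[a,b]$ and $z\notin[a,b]$, the multiplicative integral $\overset{x}{\overset{\curvearrowleft}{\underset{a}{\int}}}\mathrm{e}^{\frac{\mathrm{i}J}{z-t}H(t)dt}$ is the value at $x$ of the $m\times m$ fundamental solution of the system $w_x(x,z)=\mathrm{i}(z-x)^{-1}JH(x)w(x,z)$ $(a\le x\le b)$ normalised to equal $I_m$ at $x=a$ (equivalently, the limit of the ordered products of exponentials over partitions of $[a,x]$, with factors for larger $t$ standing to the left). *)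

(* Defs.v *)
From HB Require Import structures.
From mathcomp Require Import all_boot all_order all_algebra.
From mathcomp Require Import complex.
From mathcomp Require Import all_classical all_reals all_analysis.

Set Implicit Arguments.
Unset Strict Implicit.
Unset Printing Implicit Defensive.

Import Order.TTheory GRing.Theory Num.Theory.
Import numFieldNormedType.Exports.

Local Open Scope classical_set_scope.
Local Open Scope ring_scope.
Local Open Scope complex_scope.
Local Open Scope sesquilinear_scope.

(* R[i] as a normed space over itself, so that matrices over R[i] carry the
   library's entrywise topology. *)
HB.instance Definition _ (R : realType) := PseudoPointedMetric.copy R[i] R[i]^o.
HB.instance Definition _ (R : realType) := GRing.ComAlgebra.copy R[i] R[i]^o.
HB.instance Definition _ (R : realType) := Vector.copy R[i] R[i]^o.
HB.instance Definition _ (R : realType) := NormedModule.copy R[i] R[i]^o.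

Definition l2norm (R : realType) (p : nat) (v : 'cV[R[i]]_p) : R :=
  Num.sqrt (\sum_(i < p) (Normc.normc (v i ord0)) ^+ 2).

Definition opnorm (R : realType) (p q : nat) (A : 'M[R[i]]_(p, q)) : R :=
  sup [set l2norm (A *m v) | v in [set v : 'cV[R[i]]_q | l2norm v <= 1]].

(* F has derivative F' at every point of [a, b], relative to [a, b]: two-sided
   in the interior, one-sided at a and at b. *)
Definition deriv_on (R : realType) (p q : nat) (a b : R)
    (F F' : R -> 'M[R[i]]_(p, q)) : Prop :=
  forall x : R, a <= x <= b ->
    ((y - x)%:C)^-1 *: (F y - F x) @[y --> within `[a, b] x^'] --> F' x.

(* w is x |-> (multiplicative integral from a to x of e^{iJH(t)dt/(z-t)}), the
   normalised fundamental solution on [a, b]. It is taken in the classical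
   sense, which for continuous H and z outside [a, b] is the same as the
   absolutely continuous one; it is then unique on [a, b]. *)
Definition is_mult_integral (R : realType) (m : nat) (a b : R)
    (J : 'M[R[i]]_m) (H : R -> 'M[R[i]]_m) (z : R[i])
    (w : R -> 'M[R[i]]_m) : Prop :=
  w a = 1%:M /\
  deriv_on a b w (fun x => ('i%C / (z - x%:C)) *: (J *m H x *m w x)).

Definition resolvent (R : realType) (n : nat) (B : 'M[R[i]]_n) (x : R) :
    'M[R[i]]_n :=
  invmx (B - (x%:C)%:M).

Definition darboux0 (R : realType) (m n : nat) (J : 'M[R[i]]_m)
    (A S : R -> 'M[R[i]]_n) (P : R -> 'M[R[i]]_(n, m)) (x : R) :
    'M[R[i]]_m :=
  1%:M - 'i%C *: (J *m (P x)^t* *m invmx (S x) *m invmx (A x) *m P x).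

Definition jump (R : realType) (m : nat) (W : R -> R[i] -> 'M[R[i]]_m)
    (x s eta : R) : 'M[R[i]]_m :=
  W x (s +i* eta) - W x (s -i* eta).

(* Main.v *)
Require Import Defs.
From HB Require Import structures.
From mathcomp Require Import all_boot all_order all_algebra.
From mathcomp Require Import complex.
From mathcomp Require Import all_classical all_reals all_analysis.
From mathcomp Require Import ring lra.

Set Implicit Arguments.
Unset Strict Implicit.
Unset Printing Implicit Defensive.

Import Order.TTheory GRing.Theory Num.Theory.
Import numFieldNormedType.Exports.

Local Open Scope classical_set_scope.
Local Open Scope ring_scope.
Local Open Scope complex_scope.
Local Open Scope sesquilinear_scope.

(* The transformation preserves the class of Hamiltonians: A S - S A^* = i P J P^*
   persists along the flow, so w0 J w0^* = J; as w0 is Lipschitz,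
   w0(x) J w0(t)^* = J + O(|x - t|), and betat inherits both conditions of beta.

   For gamma = betat, let W be the fundamental solution at z = s + i eta.
   u = gamma W satisfies u(x) = gamma(x) + int_a^x i (z - t)^-1 gamma(x) J gamma(t)^* u(t) dt,
   whose kernel is bounded for x <= s because |gamma(x) J gamma(t)^*| <= M (x - t),
   so u stays bounded up to the singularity while W grows at most like log (1/eta).
   The reversed solution v(t) = W(x, zbar) J W(t, z)^* gamma(t)^* is treated
   likewise for t >= s. Since W(x, zbar)^-1 = J W(x, z)^* J,
     W(x, z) - W(x, zbar) = int_a^x 2 eta / ((t - s)^2 + eta^2) v(t) u(t) dt,
   a Poisson integral. Near t = s the product v u deviates from v(s) u(s) by
   o(1) + O(|t - s| log^4 (1/eta)), which the Poisson kernel makes negligible, and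
   u(s), v(s) converge as eta -> 0. *)

(** * The entrywise norm on complex matrices *)

(** The obstacle is that the pole is cancelled on one side only: |x - t| <= |s - t| holds for t <= x
    <= s and fails once x passes s. Hence two solutions are run towards s, one from a and one
    backwards from x, and in the product v u only the factor that is bounded on the given side may
    be evaluated away from s. On the wrong side only logarithmic bounds remain, and log^4 counts
    these losses: W costs one logarithm up to s and two beyond it, where it is a product of a
    forward and a reversed solution; the reversed solution to the left of s contains W(t) and the
    inverse of W(x) and costs three; integration against the Cauchy kernel adds the fourth. Cutting
    at |t - s| = sqrt eta then suffices, because sqrt eta log^4 (1/eta) tends to 0. No integral is
    formed. Each integral bound is a mean value inequality against an explicit primitive: an
    exponential for the Volterra equations, a logarithm for the Cauchy kernel, an arctangent for the
    Poisson kernel. The bound on the limit involves only a bound for gamma, M, J and b - a, which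
    makes it uniform in s and x. *)

Section EntrywiseNorm.
Context {R : realType}.

(** A real-valued norm, submultiplicative and invariant under the adjoint, that lies between
    [opnorm] and [p * q] times [opnorm]; the estimates are made in it and translated at both
    ends. *)
Definition mxl1 (p q : nat) (A : 'M[R[i]]_(p, q)) : R :=
  \sum_i \sum_j Normc.normc (A i j).

Lemma normc_ge0 (x : R[i]) : 0 <= Normc.normc x.
Proof. by case: x => x y /=; apply: sqrtr_ge0. Qed.

Lemma normcE (x : R[i]) : `|x| = (Normc.normc x)%:C.
Proof. by case: x. Qed.

Lemma normc_conj (x : R[i]) : Normc.normc (Num.conj x) = Normc.normc x.
Proof. by case: x => x y /=; rewrite sqrrN. Qed.

Lemma normc_real (x : R) : Normc.normc (x%:C) = `|x|.
Proof. by rewrite /= expr0n addr0 sqrtr_sqr. Qed.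

Lemma normc0 : Normc.normc (0 : R[i]) = 0.
Proof. by rewrite /= expr0n addr0 sqrtr0. Qed.

Lemma mxl1_ge0 p q (A : 'M[R[i]]_(p, q)) : 0 <= mxl1 A.
Proof. by apply: sumr_ge0 => i _; apply: sumr_ge0 => j _; apply: normc_ge0. Qed.

Lemma mxl10 p q : mxl1 (0 : 'M[R[i]]_(p, q)) = 0.
Proof.
by apply: big1 => i _; apply: big1 => j _; rewrite mxE; exact: normc0.
Qed.

Lemma le_normc_mxl1 p q (A : 'M[R[i]]_(p, q)) i j :
  Normc.normc (A i j) <= mxl1 A.
Proof.
rewrite /mxl1 (bigD1 i) //= (bigD1 j) //= -addrA lerDl.
apply: addr_ge0; first by apply: sumr_ge0 => ? _; apply: normc_ge0.
by apply: sumr_ge0 => ? _; apply: sumr_ge0 => ? _; apply: normc_ge0.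
Qed.

Lemma mxl1_eq0 p q (A : 'M[R[i]]_(p, q)) : mxl1 A <= 0 -> A = 0.
Proof.
move=> A0; apply/matrixP => i j; rewrite mxE; apply: Normc.eq0_normc.
by apply/eqP; rewrite eq_le normc_ge0 (le_trans (le_normc_mxl1 A i j)).
Qed.

Lemma mxl1D p q (A B : 'M[R[i]]_(p, q)) : mxl1 (A + B) <= mxl1 A + mxl1 B.
Proof.
rewrite /mxl1 -big_split /=; apply: ler_sum => i _.
rewrite -big_split /=; apply: ler_sum => j _.
by rewrite mxE le_normcD.
Qed.

Lemma mxl1N p q (A : 'M[R[i]]_(p, q)) : mxl1 (- A) = mxl1 A.
Proof.
by apply: eq_bigr => i _; apply: eq_bigr => j _; rewrite mxE normcN.
Qed.

Lemma mxl1B p q (A B : 'M[R[i]]_(p, q)) : mxl1 (A - B) <= mxl1 A + mxl1 B.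
Proof. by rewrite -(mxl1N B) mxl1D. Qed.

Lemma mxl1_sub p q (A B : 'M[R[i]]_(p, q)) : mxl1 (A - B) = mxl1 (B - A).
Proof. by rewrite -mxl1N opprB. Qed.

Lemma mxl1_le_add p q (A B : 'M[R[i]]_(p, q)) : mxl1 A <= mxl1 B + mxl1 (A - B).
Proof. by rewrite -{1}[A](subrK B) addrC mxl1D. Qed.

Lemma mxl1Z p q c (A : 'M[R[i]]_(p, q)) : mxl1 (c *: A) = Normc.normc c * mxl1 A.
Proof.
rewrite /mxl1 mulr_sumr; apply: eq_bigr => i _.
by rewrite mulr_sumr; apply: eq_bigr => j _; rewrite mxE Normc.normcM.
Qed.

Lemma mxl1M p q r (A : 'M[R[i]]_(p, q)) (B : 'M[R[i]]_(q, r)) :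
  mxl1 (A *m B) <= mxl1 A * mxl1 B.
Proof.
rewrite /mxl1 mulr_suml; apply: ler_sum => i _.
apply: (@le_trans _ _ (\sum_j \sum_l Normc.normc (A i l) * Normc.normc (B l j))).
  apply: ler_sum => j _; rewrite mxE.
  apply: (big_ind2 (fun x y => Normc.normc x <= y)); first by rewrite normc0.
    by move=> x x' y y' h h'; rewrite (le_trans (le_normcD _ _))// lerD.
  by move=> l _; rewrite Normc.normcM.
rewrite exchange_big /= mulr_suml; apply: ler_sum => l _.
rewrite -mulr_sumr ler_wpM2l ?normc_ge0 //.
rewrite (bigD1 l) //= lerDl.
by apply: sumr_ge0 => ? _; apply: sumr_ge0 => ? _; apply: normc_ge0.
Qed.

Lemma mxl1_adj p q (A : 'M[R[i]]_(p, q)) : mxl1 (A^t*) = mxl1 A.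
Proof.
rewrite /mxl1 exchange_big /=; apply: eq_bigr => i _; apply: eq_bigr => j _.
by rewrite !mxE normc_conj.
Qed.

Lemma mxl1_le (p q : nat) (A : 'M[R[i]]_(p, q)) c :
  (forall i j, Normc.normc (A i j) <= c) -> mxl1 A <= (p * q)%:R * c.
Proof.
move=> h; apply: (@le_trans _ _ (\sum_(i < p) \sum_(j < q) c)).
  by apply: ler_sum => i _; apply: ler_sum => j _.
by rewrite !sumr_const !card_ord -mulrnA mulr_natl mulnC.
Qed.

Lemma adjmxM p q r (A : 'M[R[i]]_(p, q)) (B : 'M[R[i]]_(q, r)) :
  (A *m B)^t* = B^t* *m A^t*.
Proof. by rewrite trmx_mul map_mxM. Qed.

Lemma adjmxK p q (A : 'M[R[i]]_(p, q)) : (A^t*)^t* = A.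
Proof. by apply/matrixP => i j; rewrite !mxE conjCK. Qed.

Lemma adjmxD p q (A B : 'M[R[i]]_(p, q)) : (A + B)^t* = A^t* + B^t*.
Proof. by rewrite linearD /= map_mxD. Qed.

Lemma adjmxN p q (A : 'M[R[i]]_(p, q)) : (- A)^t* = - A^t*.
Proof. by rewrite linearN /= map_mxN. Qed.

Lemma adjmxB p q (A B : 'M[R[i]]_(p, q)) : (A - B)^t* = A^t* - B^t*.
Proof. by rewrite adjmxD adjmxN. Qed.

Lemma adjmxZ p q c (A : 'M[R[i]]_(p, q)) : (c *: A)^t* = Num.conj c *: A^t*.
Proof. by apply/matrixP => i j; rewrite !mxE rmorphM. Qed.

Lemma adjmx1 p : (1%:M : 'M[R[i]]_p)^t* = 1%:M.
Proof. by rewrite trmx1 map_mx1. Qed.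

Lemma adjmxV p (A : 'M[R[i]]_p) : (invmx A)^t* = invmx (A^t*).
Proof. by rewrite trmx_inv map_invmx. Qed.

Lemma conjc_realC (x : R) : Num.conj (x%:C : R[i]) = x%:C.
Proof. by apply: conj_Creal; rewrite complex_real. Qed.

(** The radii of balls live in [R[i]], where [0 < e] forces [e] to be real, so real tolerances
    suffice. The divisor [p * q + 1] passes from the sum to the entries and is nonzero even for
    empty matrices. *)
Lemma cvg_mxl1P {T : Type} {F : set_system T} {FF : Filter F} p q
    (f : T -> 'M[R[i]]_(p, q)) (l : 'M[R[i]]_(p, q)) :
  f x @[x --> F] --> l <->
  (forall e : R, 0 < e -> \forall x \near F, mxl1 (f x - l) <= e).
Proof.
split=> [/cvg_ballP fl e e0|fl]; last first.
  apply/cvg_ballP => e; rewrite ltcE => /= /andP[/eqP Ie Re0].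
  have eE : e = (complex.Re e)%:C by case: e Ie {Re0} => x y /= ->.
  have e20 : 0 < complex.Re e / 2 by rewrite divr_gt0.
  apply: filterS (fl _ e20) => x fx; split.
    by rewrite eE ltcR.
  move=> i j; rewrite /ball /= /ball_ distrC normcE eE ltcR.
  have := le_normc_mxl1 (f x - l) i j; rewrite !mxE => h.
  by rewrite (le_lt_trans h)// (le_lt_trans fx)// ltr_pdivrMr// ltr_pMr ?ltr1n.
have c0 : 0 < e / (p * q + 1)%:R by rewrite divr_gt0// ltr0n addn1.
have /fl : 0 < (e / (p * q + 1)%:R)%:C :> R[i] by rewrite ltcR.
apply: filterS => x [_ h].
apply: (@le_trans _ _ ((p * q)%:R * (e / (p * q + 1)%:R))).
  apply: mxl1_le => i j; move: (h i j).
  rewrite /ball /= /ball_ distrC normcE ltcR => /ltW.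
  by rewrite !mxE.
rewrite mulrCA ler_piMr ?(ltW e0)// ler_pdivrMr ?ltr0n ?addn1//.
by rewrite mul1r ler_nat leqW.
Qed.
End EntrywiseNorm.

(** * Operator norm and differential calculus on a segment *)

Section Opnorm.
Context {R : realType}.

Lemma normc_le_l2norm p (v : 'cV[R[i]]_p) i : Normc.normc (v i ord0) <= l2norm v.
Proof.
rewrite /l2norm -[leLHS]ger0_norm ?normc_ge0// -sqrtr_sqr ler_wsqrtr//.
by rewrite (bigD1 i)//= lerDl sumr_ge0 // => j _; rewrite sqr_ge0.
Qed.

Lemma l2norm_le_mxl1 p (v : 'cV[R[i]]_p) : l2norm v <= mxl1 v.
Proof.
rewrite -[leRHS]ger0_norm ?mxl1_ge0// -sqrtr_sqr ler_wsqrtr//.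
rewrite expr2 {1}/mxl1 mulr_suml; apply: ler_sum => i _.
by rewrite big_ord1 expr2 ler_wpM2l ?normc_ge0// le_normc_mxl1.
Qed.

Lemma mxl1_mulV_le p q (A : 'M[R[i]]_(p, q)) (v : 'cV[R[i]]_q) :
  l2norm v <= 1 -> mxl1 (A *m v) <= mxl1 A.
Proof.
move=> v1; rewrite {1}/mxl1; apply: ler_sum => i _.
rewrite big_ord1 mxE.
apply: (big_ind2 (fun x y => Normc.normc x <= y)); first by rewrite normc0.
  by move=> x x' y y' h h'; rewrite (le_trans (le_normcD _ _))// lerD.
move=> j _; rewrite Normc.normcM ler_piMr ?normc_ge0//.
by rewrite (le_trans (normc_le_l2norm v j)).
Qed.

Lemma opnorm_le_mxl1 p q (A : 'M[R[i]]_(p, q)) : opnorm A <= mxl1 A.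
Proof.
apply: ge_sup.
  exists (l2norm (A *m 0)), 0 => //=.
  by rewrite /l2norm big1 ?sqrtr0// => i _; rewrite mxE normc0 expr0n.
move=> _ [v /= v1 <-].
exact: le_trans (l2norm_le_mxl1 _) (mxl1_mulV_le _ v1).
Qed.

(** Each entry is a coordinate of the image of a basis vector, and basis vectors belong to the unit
    ball. *)
Lemma mxl1_le_opnorm p q (A : 'M[R[i]]_(p, q)) :
  mxl1 A <= (p * q)%:R * opnorm A.
Proof.
apply: mxl1_le => i j.
pose e : 'cV[R[i]]_q := delta_mx j ord0.
have e1 : l2norm e <= 1.
  rewrite /l2norm (bigD1 j)//= big1 => [|l /negbTE lj].
    by rewrite addr0 mxE !eqxx Normc.normc1 expr1n sqrtr1.
  by rewrite mxE lj normc0 expr0n.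
have -> : A i j = (A *m e) i ord0 by rewrite -colE mxE.
apply: le_trans (normc_le_l2norm _ _) _.
apply: ub_le_sup; last by exists e.
exists (mxl1 A) => _ [v /= v1 <-].
exact: le_trans (l2norm_le_mxl1 _) (mxl1_mulV_le _ v1).
Qed.

End Opnorm.

(** * Continuity and differentiation on a segment, with real tolerances *)

Section Calculus.
Context {R : realType}.

Definition mxcont p q (a b : R) (F : R -> 'M[R[i]]_(p, q)) :=
  forall x, a <= x <= b -> forall e, 0 < e -> exists2 d, 0 < d &
  forall y, a <= y <= b -> `|y - x| < d -> mxl1 (F y - F x) <= e.

(* Differentiability on [a, b], one-sided at the end points: the
   epsilon-delta form of [deriv_on]. *)
Definition mxderiv p q (a b : R) (F F' : R -> 'M[R[i]]_(p, q)) :=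
  forall x, a <= x <= b -> forall e, 0 < e -> exists2 d, 0 < d &
  forall y, a <= y <= b -> `|y - x| < d ->
    mxl1 (F y - F x - (y - x)%:C *: F' x) <= e * `|y - x|.

Lemma itvccP (a b x : R) : (`[a, b]%classic x) <-> a <= x <= b.
Proof. by rewrite /= in_itv. Qed.

Lemma within_continuousP p q (a b : R) (F : R -> 'M[R[i]]_(p, q)) :
  {within `[a, b], continuous F} <-> mxcont a b F.
Proof.
split=> [/subspace_continuousP h x /itvccP xab e e0|h].
  have /cvg_mxl1P /(_ _ e0) := h x xab.
  rewrite near_withinE => /nbhs_ballP[d /= d0 hd]; exists d => // y yab yx.
  apply: (hd y); last exact/itvccP.
  by rewrite /ball /= distrC.
apply/subspace_continuousP => x /itvccP xab; apply/cvg_mxl1P => e e0.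
have [d d0 hd] := h _ xab _ e0.
rewrite near_withinE; apply/nbhs_ballP; exists d => //= y.
by rewrite /ball /= distrC => yx /itvccP yab; exact: hd.
Qed.

Lemma deriv_on_mxderiv p q (a b : R) (F F' : R -> 'M[R[i]]_(p, q)) :
  deriv_on a b F F' -> mxderiv a b F F'.
Proof.
move=> h x xab e e0.
have /cvg_mxl1P /(_ _ e0) := h _ xab.
rewrite near_withinE => /nbhs_ballP [d /= d0 hd]; exists d => // y yab yx.
have [->|nyx] := eqVneq y x.
  by rewrite !subrr scale0r subr0 mxl10 normr0 mulr0.
have y0 : (y - x)%:C != 0 :> R[i].
  by apply/eqP => -[/eqP]; rewrite subr_eq0 (negbTE nyx).
have -> : F y - F x - (y - x)%:C *: F' x =
    (y - x)%:C *: (((y - x)%:C)^-1 *: (F y - F x) - F' x).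
  by rewrite scalerBr scalerA divff// scale1r.
rewrite mxl1Z normc_real mulrC ler_wpM2r//.
move: (hd y); rewrite /ball /= distrC => /(_ yx).
by apply => //; rewrite in_itv.
Qed.

Section Rules.
Variables (p q : nat) (a b : R).
Implicit Types F G : R -> 'M[R[i]]_(p, q).

Lemma mxderivW (a' b' : R) F F' : a <= a' -> b' <= b ->
  mxderiv a b F F' -> mxderiv a' b' F F'.
Proof.
move=> aa bb h x /andP[ax xb] e e0.
have [|d d0 hd] := h x _ e e0; first by rewrite (le_trans aa ax) (le_trans xb).
exists d => // y /andP[ay yb] yx; apply: hd => //.
by rewrite (le_trans aa ay) (le_trans yb).
Qed.

Lemma mxcontW (a' b' : R) F : a <= a' -> b' <= b ->
  mxcont a b F -> mxcont a' b' F.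
Proof.
move=> aa bb h x /andP[ax xb] e e0.
have [|d d0 hd] := h x _ e e0; first by rewrite (le_trans aa ax) (le_trans xb).
exists d => // y /andP[ay yb] yx; apply: hd => //.
by rewrite (le_trans aa ay) (le_trans yb).
Qed.

Lemma eq_mxderiv F G F' G' : (forall x, a <= x <= b -> F x = G x) ->
  (forall x, a <= x <= b -> F' x = G' x) ->
  mxderiv a b F F' -> mxderiv a b G G'.
Proof.
move=> FG FG' h x xab e e0; have [d d0 hd] := h x xab e e0.
by exists d => // y yab yx; rewrite -!FG// -FG'//; exact: hd.
Qed.

Lemma mxderiv_cst (C : 'M[R[i]]_(p, q)) : mxderiv a b (fun=> C) (fun=> 0).
Proof.
move=> x _ e e0; exists 1 => // y _ _.
by rewrite subrr scaler0 subr0 mxl10 mulr_ge0// ltW.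
Qed.

Lemma mxderivD F F' G G' : mxderiv a b F F' -> mxderiv a b G G' ->
  mxderiv a b (fun x => F x + G x) (fun x => F' x + G' x).
Proof.
move=> hF hG x xab e e0; have e20 : 0 < e / 2 by rewrite divr_gt0.
have [d d0 hd] := hF x xab _ e20; have [d' d0' hd'] := hG x xab _ e20.
exists (Num.min d d'); first by rewrite lt_min d0.
move=> y yab; rewrite lt_min => /andP[yd yd'].
have -> : F y + G y - (F x + G x) - (y - x)%:C *: (F' x + G' x) =
    (F y - F x - (y - x)%:C *: F' x) + (G y - G x - (y - x)%:C *: G' x).
  by apply/matrixP => i j; rewrite !mxE; ring.
apply: le_trans (mxl1D _ _) _.
have -> : e * `|y - x| = e / 2 * `|y - x| + e / 2 * `|y - x| by field.
by apply: lerD; [exact: hd|exact: hd'].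
Qed.

Lemma mxderivN F F' : mxderiv a b F F' ->
  mxderiv a b (fun x => - F x) (fun x => - F' x).
Proof.
move=> hF x xab e e0; have [d d0 hd] := hF x xab e e0.
exists d => // y yab yd.
by rewrite scalerN -!opprD mxl1N; exact: hd.
Qed.

Lemma mxderivB F F' G G' : mxderiv a b F F' -> mxderiv a b G G' ->
  mxderiv a b (fun x => F x - G x) (fun x => F' x - G' x).
Proof. by move=> hF hG; apply: mxderivD => //; exact: mxderivN. Qed.

Lemma mxderiv_adj F F' : mxderiv a b F F' ->
  mxderiv a b (fun x => (F x)^t*) (fun x => (F' x)^t*).
Proof.
move=> hF x xab e e0; have [d d0 hd] := hF x xab e e0.
exists d => // y yab yd.
by rewrite -(conjc_realC (y - x)) -adjmxZ -!adjmxB mxl1_adj; exact: hd.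
Qed.

Lemma mxderiv_cont F F' : mxderiv a b F F' -> mxcont a b F.
Proof.
move=> hF x xab e e0; have [d d0 hd] := hF x xab 1 ltr01.
have k0 : 0 < 1 + mxl1 (F' x) by rewrite ltr_pwDl// mxl1_ge0.
exists (Num.min d (e / (1 + mxl1 (F' x)))); first by rewrite lt_min d0 divr_gt0.
move=> y yab; rewrite lt_min => /andP[yd ye].
rewrite (le_trans (mxl1_le_add _ ((y - x)%:C *: F' x)))//.
apply: le_trans (lerD (lexx _) (hd _ yab yd)) _.
rewrite mxl1Z normc_real mulrC -mulrDl addrC.
by rewrite -ler_pdivlMl// mulrC ltW.
Qed.

Lemma mxderiv_scale (g g' : R -> R) (C : 'M[R[i]]_(p, q)) :
  (forall x, a <= x <= b -> is_derive x 1 g (g' x)) ->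
  mxderiv a b (fun x => (g x)%:C *: C) (fun x => (g' x)%:C *: C).
Proof.
move=> hg x xab e e0.
have c0 : 0 < 1 + mxl1 C by rewrite ltr_pwDl// mxl1_ge0.
have [dg dgE] := hg x xab.
have /cvgrPdist_le /(_ (e / (1 + mxl1 C))) := dg.
rewrite divr_gt0// => /(_ isT).
rewrite -[lim _]/('D_1 g x) dgE => /nbhs_ballP[d /= d0 hd].
exists d => // y yab yx.
have [->|nyx] := eqVneq y x.
  by rewrite !subrr scale0r subr0 mxl10 normr0 mulr0.
have yx0 : y - x != 0 by rewrite subr_eq0.
rewrite -scalerBl -rmorphB /= scalerA -rmorphM /= -scalerBl -rmorphB /=.
rewrite mxl1Z normc_real.
move: (hd (y - x)); rewrite /ball /= sub0r normrN => /(_ yx yx0).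
rewrite /= [_%:A]mulr1 subrK distrC => h.
have -> : g y - g x - (y - x) * g' x = (y - x) * ((y - x)^-1 *: (g y - g x) - g' x).
  by rewrite mulrBr /GRing.scale /= mulrA divff// mul1r.
rewrite normrM -mulrA [leRHS]mulrC ler_wpM2l//.
apply: le_trans (ler_wpM2r (mxl1_ge0 _) h) _.
by rewrite -mulrA ler_piMr ?(ltW e0)// mulrC ler_pdivrMr// mul1r lerDr ler01.
Qed.

End Rules.

Lemma mxderivM p q r (a b : R) (F F' : R -> 'M[R[i]]_(p, q))
    (G G' : R -> 'M[R[i]]_(q, r)) : mxderiv a b F F' -> mxderiv a b G G' ->
  mxderiv a b (fun x => F x *m G x) (fun x => F' x *m G x + F x *m G' x).
Proof.
move=> hF hG x xab e e0.
set cF' := 1 + mxl1 (F' x); set cF := 1 + mxl1 (F x); set cG := 1 + mxl1 (G x).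
have cF'0 : 0 < cF' by rewrite ltr_pwDl// mxl1_ge0.
have cF0 : 0 < cF by rewrite ltr_pwDl// mxl1_ge0.
have cG0 : 0 < cG by rewrite ltr_pwDl// mxl1_ge0.
have [d1 d10 hd1] := hF x xab (e / 3 / cG) ltac:(by rewrite !divr_gt0).
have [d2 d20 hd2] := hG x xab (e / 3 / cF) ltac:(by rewrite !divr_gt0).
have [d3 d30 hd3] :=
  mxderiv_cont hG xab (ltac:(by rewrite !divr_gt0) : 0 < e / 3 / cF').
have [d4 d40 hd4] := mxderiv_cont hG xab ltr01.
exists (Num.min (Num.min d1 d2) (Num.min d3 d4)).
  by rewrite !lt_min d10 d20 d30 d40.
move=> y yab; rewrite !lt_min => /andP[/andP[yd1 yd2] /andP[yd3 yd4]].
(* The error of [F] meets [G y], its linear part meets the increment of [G], and [F x] meets the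
   error of [G]; each product receives a third of [e]. *)
have -> : F y *m G y - F x *m G x
    - (y - x)%:C *: (F' x *m G x + F x *m G' x) =
    (F y - F x - (y - x)%:C *: F' x) *m G y
    + ((y - x)%:C *: F' x) *m (G y - G x)
    + F x *m (G y - G x - (y - x)%:C *: G' x).
  rewrite !mulmxBl !mulmxBr scalerDr -!scalemxAl -!scalemxAr.
  move: (F y *m G y) (F x *m G x) (F x *m G y) (F' x *m G x) (F' x *m G y).
  move=> *; move: (F x *m G' x) => *.
  by apply/matrixP => i j; rewrite !mxE; ring.
rewrite (le_trans (mxl1D _ _))//.
have e3 : e = e / 3 + e / 3 + e / 3 by field.
rewrite [e in leRHS]e3 !mulrDl lerD//.
  rewrite (le_trans (mxl1D _ _))// lerD//.
    apply: le_trans (mxl1M _ _) _.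
    have Gy : mxl1 (G y) <= cG.
      by rewrite (le_trans (mxl1_le_add _ (G x)))// addrC lerD// hd4.
    apply: le_trans (ler_pM (mxl1_ge0 _) (mxl1_ge0 _) (hd1 _ yab yd1) Gy) _.
    by rewrite mulrAC divfK// gt_eqF.
  apply: le_trans (mxl1M _ _) _.
  rewrite mxl1Z normc_real -[leLHS]mulrA [leRHS]mulrC ler_wpM2l//.
  have F'c : mxl1 (F' x) <= cF' by rewrite lerDr.
  apply: le_trans (ler_pM (mxl1_ge0 _) (mxl1_ge0 _) F'c (hd3 _ yab yd3)) _.
  by rewrite mulrC divfK// gt_eqF.
apply: le_trans (mxl1M _ _) _.
have Fc : mxl1 (F x) <= cF by rewrite lerDr.
apply: le_trans (ler_pM (mxl1_ge0 _) (mxl1_ge0 _) Fc (hd2 _ yab yd2)) _.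
by rewrite mulrA [cF * _]mulrC divfK// gt_eqF.
Qed.

Lemma mxderivMl p q r (a b : R) (C : 'M[R[i]]_(p, q))
    (G G' : R -> 'M[R[i]]_(q, r)) : mxderiv a b G G' ->
  mxderiv a b (fun x => C *m G x) (fun x => C *m G' x).
Proof.
move=> hG; have := mxderivM (@mxderiv_cst _ _ a b C) hG.
by apply: eq_mxderiv => // x _; rewrite mul0mx add0r.
Qed.

Lemma mxderivMr p q r (a b : R) (C : 'M[R[i]]_(q, r))
    (F F' : R -> 'M[R[i]]_(p, q)) : mxderiv a b F F' ->
  mxderiv a b (fun x => F x *m C) (fun x => F' x *m C).
Proof.
move=> hF; have := mxderivM hF (@mxderiv_cst _ _ a b C).
by apply: eq_mxderiv => // x _; rewrite mulmx0 addr0.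
Qed.

Lemma mxderiv_opp p q (a b : R) (F F' : R -> 'M[R[i]]_(p, q)) :
  mxderiv a b F F' ->
  mxderiv (- b) (- a) (fun x => F (- x)) (fun x => - F' (- x)).
Proof.
have opp (x : R) : - b <= x <= - a -> a <= - x <= b.
  by rewrite lerNl lerNr andbC.
move=> hF x /opp xab e e0; have [d d0 hd] := hF _ xab e e0.
exists d => // y /opp yab yx.
have E : - y - - x = - (y - x) by rewrite opprB opprK addrC.
have := hd _ yab; rewrite E normrN => /(_ yx).
by rewrite rmorphN /= scaleNr scalerN.
Qed.

Lemma mxcont_opp p q (a b : R) (F : R -> 'M[R[i]]_(p, q)) :
  mxcont a b F -> mxcont (- b) (- a) (fun x => F (- x)).
Proof.
have opp (x : R) : - b <= x <= - a -> a <= - x <= b.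
  by rewrite lerNl lerNr andbC.
move=> hF x /opp xab e e0; have [d d0 hd] := hF _ xab e e0.
exists d => // y /opp yab yx; apply: hd => //.
by rewrite -normrN opprD !opprK.
Qed.

Lemma mxcontM p q r (a b : R) (F : R -> 'M[R[i]]_(p, q))
    (G : R -> 'M[R[i]]_(q, r)) : mxcont a b F -> mxcont a b G ->
  mxcont a b (fun x => F x *m G x).
Proof.
move=> hF hG x xab e e0.
set cF := 1 + mxl1 (F x); set cG := 1 + mxl1 (G x).
have cF0 : 0 < cF by rewrite ltr_pwDl// mxl1_ge0.
have cG0 : 0 < cG by rewrite ltr_pwDl// mxl1_ge0.
have [d1 d10 hd1] := hF x xab (e / 2 / cG) ltac:(by rewrite !divr_gt0).
have [d2 d20 hd2] := hG x xab (e / 2 / cF) ltac:(by rewrite !divr_gt0).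
have [d4 d40 hd4] := hG x xab _ ltr01.
exists (Num.min d1 (Num.min d2 d4)); first by rewrite !lt_min d10 d20 d40.
move=> y yab; rewrite !lt_min => /and3P[yd1 yd2 yd4].
have -> : F y *m G y - F x *m G x =
    (F y - F x) *m G y + F x *m (G y - G x).
  by rewrite mulmxBl mulmxBr addrA subrK.
rewrite (le_trans (mxl1D _ _))// [e in leRHS]splitr lerD//.
  apply: le_trans (mxl1M _ _) _.
  have Gy : mxl1 (G y) <= cG.
    by rewrite (le_trans (mxl1_le_add _ (G x)))// addrC lerD// hd4.
  apply: le_trans (ler_pM (mxl1_ge0 _) (mxl1_ge0 _) (hd1 _ yab yd1) Gy) _.
  by rewrite divfK// gt_eqF.
apply: le_trans (mxl1M _ _) _.
have Fc : mxl1 (F x) <= cF by rewrite lerDr.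
apply: le_trans (ler_pM (mxl1_ge0 _) (mxl1_ge0 _) Fc (hd2 _ yab yd2)) _.
by rewrite mulrC divfK// gt_eqF.
Qed.

End Calculus.

(** * Mean value inequalities *)

Section MeanValue.
Context {R : realType}.

Lemma Re_le_normc (z : R[i]) : complex.Re z <= Normc.normc z.
Proof.
case: z => x y /=; rewrite (le_trans (ler_norm x))// -sqrtr_sqr ler_wsqrtr//.
by rewrite lerDl sqr_ge0.
Qed.

Lemma ReD (y z : R[i]) : complex.Re (y + z) = complex.Re y + complex.Re z.
Proof. by case: y => ? ?; case: z. Qed.

Lemma ReZ (c : R) (z : R[i]) : complex.Re (c%:C * z) = c * complex.Re z.
Proof. by case: z => x y /=; rewrite mul0r subr0. Qed.

Lemma normc_phase (z : R[i]) : exists2 w : R[i], Normc.normc w <= 1 &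
  w * z = (Normc.normc z)%:C.
Proof.
have [->|z0] := eqVneq z 0; first by exists 0; rewrite ?mul0r ?normc0.
have nz0 : Normc.normc z != 0 by apply: contra z0 => /eqP /Normc.eq0_normc ->.
exists (Num.conj z / (Normc.normc z)%:C).
  by rewrite Normc.normcM normc_conj Normc.normcV normc_real ger0_norm
     ?normc_ge0// divff.
rewrite mulrAC [_ * z]mulrC -normCK normcE expr2 mulfK//.
by apply/eqP => -[/eqP]; rewrite (negbTE nz0).
Qed.

(* Duality for the entrywise norm: reduces the mean value inequality to a
   real-valued function. *)
Lemma mxl1_dual p q (D : 'M[R[i]]_(p, q)) :
  exists l : 'M[R[i]]_(p, q) -> R, [/\ forall X Y, l (X + Y) = l X + l Y,
    forall c X, l (c%:C *: X) = c * l X, forall X, `|l X| <= mxl1 X &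
    l D = mxl1 D].
Proof.
have /choice [w wE] (ij : 'I_p * 'I_q) : exists w : R[i],
    Normc.normc w <= 1 /\ w * D ij.1 ij.2 = (Normc.normc (D ij.1 ij.2))%:C.
  by have [w] := normc_phase (D ij.1 ij.2); exists w.
pose l (X : 'M[R[i]]_(p, q)) := \sum_i \sum_j complex.Re (w (i, j) * X i j).
have lle X : l X <= mxl1 X.
  apply: ler_sum => i _; apply: ler_sum => j _.
  rewrite (le_trans (Re_le_normc _))// Normc.normcM ler_piMl ?normc_ge0//.
  exact: (wE (i, j)).1.
have lD X Y : l (X + Y) = l X + l Y.
  rewrite /l -big_split /=; apply: eq_bigr => i _.
  rewrite -big_split /=; apply: eq_bigr => j _.
  by rewrite mxE mulrDr ReD.
have lZ c X : l (c%:C *: X) = c * l X.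
  rewrite /l mulr_sumr; apply: eq_bigr => i _.
  rewrite mulr_sumr; apply: eq_bigr => j _.
  by rewrite mxE mulrCA ReZ.
exists l; split => //.
  move=> X; rewrite ler_norml lle andbT lerNl.
  have -> : - l X = l ((-1)%:C *: X) by rewrite lZ mulN1r.
  by rewrite (le_trans (lle _))// mxl1Z normc_real normrN1 mul1r.
apply: eq_bigr => i _; apply: eq_bigr => j _.
by rewrite (wE (i, j)).2.
Qed.

(** This takes the place of integrating a bound on the derivative, with [g] as the primitive. The
    functional [l] that attains the norm of the total increment reduces the claim to a real
    function, and the mean value theorem is applied to [g - l F], whose derivative is
    nonnegative. *)
Lemma mxderiv_le p q (a b : R) (F F' : R -> 'M[R[i]]_(p, q)) (g g' : R -> R) :
  a <= b -> mxderiv a b F F' ->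
  (forall t, a <= t <= b -> is_derive t 1 g (g' t)) ->
  (forall t, a <= t <= b -> mxl1 (F' t) <= g' t) ->
  mxl1 (F b - F a) <= g b - g a.
Proof.
rewrite le_eqVlt => /predU1P[-> _ _ _|ab hF hg F'g].
  by rewrite !subrr mxl10.
have [l [lD lZ lle lE]] := mxl1_dual (F b - F a).
have lB X Y : l (X - Y) = l X - l Y.
  have -> : - Y = (-1)%:C *: Y by rewrite rmorphN1 scaleN1r.
  by rewrite lD lZ mulN1r.
pose f t := l (F t).
have f'E t : t \in `]a, b[ -> is_derive t 1 f (l (F' t)).
  rewrite in_itv /= => /andP[at_ tb].
  have tab : a <= t <= b by rewrite !ltW.
  suff h : (h^-1 *: (f (h *: 1 + t) - f t)) @[h --> 0^'] --> l (F' t).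
    by split; [apply: cvgP; exact: h|apply/cvg_lim; first by []; exact: h].
  apply/cvgrPdist_le => e e0.
  have [d d0 hd] := hF t tab e e0.
  (* Inside the open interval a small step keeps [h + t] in [a, b], so the derivative relative to
     the segment is two-sided there. *)
  apply/nbhs_ballP; exists (Num.min d (Num.min (t - a) (b - t))) => /=.
    by rewrite !lt_min d0 !subr_gt0 at_ tb.
  move=> h; rewrite /ball /= sub0r normrN !lt_min => /and3P[hd' ha hb] h0.
  have hab : a <= h + t <= b.
    move: ha hb; rewrite !ltr_norml => /andP[ha _] /andP[_ hb].
    by apply/andP; split; lra.
  have := hd (h + t) hab; rewrite addrK => /(_ hd').
  move=> /(le_trans (lle _)); rewrite !lB lZ.
  rewrite /f /= [h%:A]mulr1 -ler_pdivrMr ?normr_gt0// -normfV -normrM.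
  rewrite distrC mulrBl [h * _]mulrC mulfK// /GRing.scale /= mulrC.
  by [].
have [||c cab] := @MVT R (g \- f) (fun t => g' t - l (F' t)) a b ab.
- move=> t tab; apply: is_deriveB; last exact: f'E.
  apply: hg; move: tab; rewrite in_itv /= => /andP[h1 h2].
  by rewrite !ltW.
- apply/subspace_continuousP => t /itvccP tab.
  apply: cvgB.
    apply: cvg_within_filter; apply: differentiable_continuous.
    by apply/derivable1_diffP; have [] := hg t tab.
  apply/cvgrPdist_le => e e0; have [d d0 hd] := mxderiv_cont hF tab e0.
  rewrite near_withinE; apply/nbhs_ballP; exists d => //= y.
  rewrite /ball /= distrC => yx /itvccP yab.
  by rewrite -lB (le_trans (lle _))// mxl1_sub hd.
move=> /= E.
rewrite -subr_ge0 -lE lB.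
have -> : g b - g a - (l (F b) - l (F a)) = g b - f b - (g a - f a).
  by rewrite /f; ring.
rewrite E mulr_ge0 ?subr_ge0 ?(ltW ab)//.
move: cab; rewrite in_itv /= => /andP[h1 h2].
apply: le_trans (ler_norm _) _; apply: le_trans (lle _) _.
by apply: F'g; rewrite !ltW.
Qed.

Lemma mxderiv0_const p q (a b : R) (F : R -> 'M[R[i]]_(p, q)) :
  mxderiv a b F (fun=> 0) -> forall x, a <= x <= b -> F x = F a.
Proof.
move=> hF x /andP[ax xb]; apply/eqP; rewrite -subr_eq0; apply/eqP.
apply: mxl1_eq0.
have -> : 0 = (cst 0 : R -> R) x - (cst 0 : R -> R) a by rewrite subrr.
apply: (@mxderiv_le _ _ a x F (fun=> 0) _ (fun=> 0)) => //.
  exact: mxderivW hF.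
by move=> t _; rewrite mxl10.
Qed.

Lemma mxcont_bounded p q (a b : R) (F : R -> 'M[R[i]]_(p, q)) : a <= b ->
  mxcont a b F -> exists2 C, 0 < C & forall x, a <= x <= b -> mxl1 (F x) <= C.
Proof.
move=> ab hF.
have hc : {within `[a, b], continuous (fun x => mxl1 (F x))}.
  apply/subspace_continuousP => t /itvccP tab.
  apply/cvgrPdist_le => e e0; have [d d0 hd] := hF _ tab _ e0.
  rewrite near_withinE; apply/nbhs_ballP; exists d => //= y.
  rewrite /ball /= distrC => yx /itvccP yab; have h := hd _ yab yx.
  have := mxl1_le_add (F y) (F t); have := mxl1_le_add (F t) (F y).
  rewrite mxl1_sub => h1 h2.
  rewrite ler_distl lerBlDr (le_trans h2) ?lerD2l//=.
  by rewrite (le_trans h1)// lerD2l.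
have [c _ hC] := EVT_max ab hc.
exists (1 + mxl1 (F c)); first by rewrite ltr_pwDl// mxl1_ge0.
move=> x xab; rewrite (le_trans (hC x _))//; last by rewrite lerDr.
Qed.

Lemma is_derive_cmul (c x : R) : is_derive x 1 (fun t => c * t) c.
Proof.
have h : is_derive x (1 : R) (c \*: (@id R^o)) (c *: (1 : R)).
  exact: is_deriveZ.
by rewrite /GRing.scale /= mulr1 in h.
Qed.

Lemma mxderiv_lip p q (a b : R) (F F' : R -> 'M[R[i]]_(p, q)) (C : R) :
  mxderiv a b F F' -> (forall x, a <= x <= b -> mxl1 (F' x) <= C) ->
  forall x t, a <= t -> t <= x -> x <= b -> mxl1 (F x - F t) <= C * (x - t).
Proof.
move=> hF hC x t at_ tx xb.
rewrite mulrBr; apply: (@mxderiv_le _ _ t x F F' (fun y => C * y) (fun=> C)) => //.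
- exact: mxderivW hF.
- by move=> y _; exact: is_derive_cmul.
- by move=> y /andP[ty yx]; apply: hC; rewrite (le_trans at_)//= (le_trans yx).
Qed.

(** A Gronwall argument by weights. Let m be the supremum of d(t) exp (- k (t - a)), finite thanks
    to [C0]; the hypothesis improves m to G + m / 2, hence m <= 2 G. [C0] leaves no trace in the
    bound, which matters because in the application it depends on eta. *)
Lemma weighted_sup_bound (a b k G C0 : R) (d : R -> R) : a <= b -> 0 <= k -> 0 <= G ->
  (forall t, a <= t <= b -> 0 <= d t <= C0) ->
  (forall m, 0 <= m ->
    (forall t, a <= t <= b -> d t <= m * expR (k * (t - a))) ->
    forall t, a <= t <= b -> d t <= G + m / 2 * expR (k * (t - a))) ->
  forall t, a <= t <= b -> d t <= 2 * G * expR (k * (b - a)).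
Proof.
move=> ab k0 G0 dC h.
pose E := [set d t * expR (- (k * (t - a))) | t in [set t | a <= t <= b]].
have aab : a <= a <= b by rewrite lexx.
have Eub : ubound E C0.
  move=> _ [t /= tab <-]; have /andP[d0 dt] := dC t tab.
  rewrite (le_trans _ dt)// ler_piMr// -expR0 ler_expR oppr_le0 mulr_ge0//.
  by rewrite subr_ge0; case/andP: tab.
have E0 : E !=set0 by exists (d a * expR (- (k * (a - a)))), a.
have le_m t : a <= t <= b -> d t <= sup E * expR (k * (t - a)).
  move=> tab; rewrite -ler_pdivrMr ?expR_gt0// -expRN.
  by apply: ub_le_sup; [exists C0|exists t].
have m0 : 0 <= sup E.
  apply: le_trans (_ : d a * expR (- (k * (a - a))) <= _).
    by rewrite mulr_ge0 ?expR_ge0//; case/andP: (dC a aab).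
  by apply: ub_le_sup; [exists C0|exists a].
have h' := h _ m0 le_m.
have mG : sup E <= G + sup E / 2.
  apply: ge_sup => // _ [t /= tab <-].
  have e1 : expR (- (k * (t - a))) <= 1.
    rewrite -expR0 ler_expR oppr_le0 mulr_ge0// subr_ge0.
    by case/andP: tab.
  apply: le_trans (ler_wpM2r (expR_ge0 _) (h' t tab)) _.
  have ee : expR (k * (t - a)) * expR (- (k * (t - a))) = 1.
    by rewrite -expRD subrr expR0.
  by rewrite mulrDl -[X in _ + X]mulrA ee mulr1 lerD2r ler_piMr.
move=> t tab; apply: le_trans (le_m t tab) _.
apply: ler_pM; rewrite ?expR_ge0//; first by lra.
by rewrite ler_expR ler_wpM2l// lerD2r; case/andP: tab.
Qed.

Lemma is_derive_ln_affine (c k x : R) : 0 < k * x + c ->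
  is_derive x 1 (fun t => ln (k * t + c)) (k / (k * x + c)).
Proof.
move=> x0.
have h1 : is_derive x 1 (fun t => k * t + c) k.
  have := is_deriveD (is_derive_cmul k x) (is_derive_cst c x (1 : R)).
  by rewrite addr0.
have h2 := is_derive1_ln x0.
by have := @is_derive1_comp R (@ln R) (fun t => k * t + c) x _ _ h2 h1; rewrite mulrC.
Qed.

(* [lg L th] is the integral of 1 / (r + th) over [0, L]. *)
Definition lg (L th : R) : R := ln ((L + th) / th).

Lemma lg_ge0 L th : 0 <= L -> 0 < th -> 0 <= lg L th.
Proof.
by move=> L0 t0; rewrite ln_ge0// ler_pdivlMr// mul1r lerDr.
Qed.

(** The left side is the integral of 1 / (r + th) over [y, x], a part of [0, L]. *)
Lemma ln_ratio_le_lg (L th x y : R) : 0 < th -> 0 <= y -> y <= x -> x <= L ->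
  ln (x + th) - ln (y + th) <= lg L th.
Proof.
move=> t0 y0 yx xL.
have yt : 0 < y + th by rewrite ltr_wpDl.
have xt : 0 < x + th by rewrite (lt_le_trans yt)// lerD2r.
have Lt : 0 < L + th by rewrite (lt_le_trans xt)// lerD2r.
rewrite /lg ln_div ?posrE//.
by rewrite lerB// ler_ln ?posrE ?lerD2r// lerDr.
Qed.

Lemma is_derive_lg (s c th r : R) : 0 < th -> r <= s ->
  is_derive r 1 (fun r => - c * ln (-1 * r + (s + th))) (c / (s - r + th)).
Proof.
move=> th0 rs; have h0 : 0 < -1 * r + (s + th) by lra.
have := is_deriveZ (- c) (is_derive_ln_affine h0).
rewrite (_ : _ *: _ = c / (s - r + th))// /GRing.scale /= !mulN1r.
have -> : - r + (s + th) = s - r + th by ring.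
by rewrite mulrN mulNr opprK.
Qed.

Lemma increment_lg_le (L s c th a t : R) : 0 < th -> 0 <= c ->
  a <= t -> t <= s -> s - a <= L ->
  - c * ln (-1 * t + (s + th)) - - c * ln (-1 * a + (s + th)) <= c * lg L th.
Proof.
move=> th0 c0 at_ ts sL; rewrite !mulN1r.
have -> : - c * ln (- t + (s + th)) - - c * ln (- a + (s + th)) =
    c * (ln (s - a + th) - ln (s - t + th)).
  have -> : - t + (s + th) = s - t + th by ring.
  have -> : - a + (s + th) = s - a + th by ring.
  by ring.
rewrite ler_wpM2l// ln_ratio_le_lg ?subr_ge0//.
by rewrite lerB.
Qed.

Lemma mxderiv_lg_le p q (a t s L : R) (c1 th1 c2 th2 B : R)
    (F F' : R -> 'M[R[i]]_(p, q)) :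
  a <= t -> t <= s -> s - a <= L -> 0 < th1 -> 0 < th2 -> 0 <= c1 -> 0 <= c2 ->
  mxderiv a t F F' ->
  (forall r, a <= r <= t ->
    mxl1 (F' r) <= c1 / (s - r + th1) + c2 / (s - r + th2) + B) ->
  mxl1 (F t - F a) <= c1 * lg L th1 + c2 * lg L th2 + B * (t - a).
Proof.
move=> at_ ts sL th10 th20 c10 c20 hF hF'.
pose G c th r := - c * ln (-1 * r + (s + th)).
have h := @mxderiv_le _ _ a t F F' (fun r => G c1 th1 r + G c2 th2 r + B * r)
  (fun r => c1 / (s - r + th1) + c2 / (s - r + th2) + B) at_ hF.
apply: le_trans (h _ hF') _.
  move=> r /andP[_ rt]; apply: is_deriveD; last exact: is_derive_cmul.
  by apply: is_deriveD; apply: is_derive_lg => //; rewrite (le_trans rt).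
have := increment_lg_le th10 c10 at_ ts sL.
have := increment_lg_le th20 c20 at_ ts sL.
rewrite -!/(G _ _ _).
move: (G c1 th1 t) (G c1 th1 a) (G c2 th2 t) (G c2 th2 a) => g1 g2 g3 g4.
by rewrite mulrBr; lra.
Qed.

Lemma mxderiv_lg_le_right p q (s t L c th : R) (F F' : R -> 'M[R[i]]_(p, q)) :
  s <= t -> t - s <= L -> 0 < th -> 0 <= c -> mxderiv s t F F' ->
  (forall r, s <= r <= t -> mxl1 (F' r) <= c / (r - s + th)) ->
  mxl1 (F t - F s) <= c * lg L th.
Proof.
move=> st tL th0 c0 hF hF'.
pose G r := c * ln (1 * r + (th - s)).
have dG r : s <= r -> is_derive r 1 G (c / (r - s + th)).
  move=> sr; have h0 : 0 < 1 * r + (th - s) by lra.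
  have := is_deriveZ c (is_derive_ln_affine h0).
  rewrite (_ : _ *: _ = c / (r - s + th))// /GRing.scale /= !mul1r.
  by have -> : r + (th - s) = r - s + th by ring.
have h := @mxderiv_le _ _ s t F F' G (fun r => c / (r - s + th)) st hF.
apply: le_trans (h _ hF') _; first by move=> r /andP[sr _]; exact: dG.
rewrite /G -mulrBr ler_wpM2l// !mul1r.
have -> : t + (th - s) = t - s + th by ring.
have -> : s + (th - s) = s - s + th by ring.
by rewrite ln_ratio_le_lg// subrr// subr_ge0.
Qed.

(** The integral equation for u is encoded by a family of functions: [F x a] is the inhomogeneous
    term, [F' x] the integrand, and [F x x] the value u(x); [g] is a primitive of the forcing term.
    Under the weight exp (2 M (t - a)) a kernel bounded by [M] has norm at most 1/2, which is the
    gain that [weighted_sup_bound] asks for. *)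
Lemma volterra_bound p q (a b M G g0 : R) (u : R -> 'M[R[i]]_(p, q))
    (F F' : R -> R -> 'M[R[i]]_(p, q)) (g g' : R -> R) :
  a <= b -> 0 < M -> 0 <= G ->
  mxcont a b u ->
  (forall x, a <= x <= b -> mxderiv a x (F x) (F' x)) ->
  (forall x, a <= x <= b -> F x x = u x) ->
  (forall x, a <= x <= b -> mxl1 (F x a) <= G) ->
  (forall x, a <= x <= b -> is_derive x 1 g (g' x)) ->
  (forall x, a <= x <= b -> g x - g a <= g0) -> 0 <= g0 ->
  (forall x t, a <= t -> t <= x -> x <= b ->
    mxl1 (F' x t) <= M * mxl1 (u t) + g' t) ->
  forall x, a <= x <= b -> mxl1 (u x) <= 2 * (G + g0) * expR (2 * M * (b - a)).
Proof.
move=> ab M0 G0 uc hF Fx Fa dg gg0 g00 hF'.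
have [C0 _ uC] := mxcont_bounded ab uc.
apply: (@weighted_sup_bound _ _ _ _ C0) => //.
- by rewrite mulr_ge0// ltW.
- by rewrite addr_ge0.
- by move=> t tab; rewrite mxl1_ge0 uC.
move=> m m0 um x /[dup] xab /andP[ax xb].
pose E t := m / 2 * expR (2 * M * t + - (2 * M * a)).
have EE t : E t = m / 2 * expR (2 * M * (t - a)) by rewrite /E mulrBr.
have dE (t : R) : is_derive t 1 E (m / 2 * (2 * M * expR (2 * M * (t - a)))).
  have h1 : is_derive t 1 (fun t => 2 * M * t + - (2 * M * a)) (2 * M).
    have := is_deriveD (is_derive_cmul (2 * M) t)
      (is_derive_cst (- (2 * M * a)) t (1 : R)).
    by rewrite addr0.
  have h2 := @is_derive1_comp R (@expR R)
    (fun t => 2 * M * t + - (2 * M * a)) t _ _ (is_derive_expR _) h1.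
  have := is_deriveZ (m / 2) h2.
  rewrite (_ : _ \*: _ = E)//.
  by rewrite /GRing.scale /= -mulrBr [expR _ * _]mulrC.
have h := @mxderiv_le _ _ a x (F x) (F' x) (fun t => E t + g t)
  (fun t => m / 2 * (2 * M * expR (2 * M * (t - a))) + g' t) ax (hF x xab).
have {}h : mxl1 (F x x - F x a) <= E x + g x - (E a + g a).
  apply: h => [t /andP[at_ tx]|t /andP[at_ tx]].
    by apply: is_deriveD; apply: dg; rewrite at_ (le_trans tx).
  apply: le_trans (hF' x t at_ tx xb) _.
  rewrite lerD2r.
  have -> : m / 2 * (2 * M * expR (2 * M * (t - a))) =
    M * (m * expR (2 * M * (t - a))) by field.
  by rewrite ler_wpM2l ?(ltW M0)// um// at_ (le_trans tx).
rewrite -Fx// (le_trans (mxl1_le_add _ (F x a)))//.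
have := Fa x xab; have := gg0 x xab.
have Ea : 0 <= E a by rewrite EE mulr_ge0 ?expR_ge0// divr_ge0.
rewrite EE in h; move: h Ea.
move: (m / 2 * expR _) (E a) (mxl1 _) (mxl1 _) => e1 e2 e3 e4.
by lra.
Qed.

End MeanValue.

(** * Systems with a simple pole *)

Section SingularSystem.
Context {R : realType}.
Variables (k m : nat) (J : 'M[R[i]]_m).

(* [gamma] stands for the square root of the Hamiltonian, and the second
   inequality for the smoothness of gamma(x) J gamma(t)^* near the diagonal. *)
Definition kernel_bound (gamma : R -> 'M[R[i]]_(k, m)) (a b G M : R) :=
  (forall t, a <= t <= b -> mxl1 (gamma t) <= G /\ mxl1 (J *m (gamma t)^t*) <= G)
  /\ forall x t, a <= x <= b -> a <= t <= b ->
     mxl1 (gamma x *m J *m (gamma t)^t*) <= M * `|x - t|.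

(** The scalar [c] is left abstract because the system with reversed variable carries the
    coefficient - i / (z + t) instead of i / (z - t). The Hamiltonian is factored so that
    [gamma t *m Y t] appears in the equation. *)
Definition normalized_solution (gamma : R -> 'M[R[i]]_(k, m)) (a b : R)
    (c : R -> R[i]) (Y : R -> 'M[R[i]]_m) :=
  Y a = 1%:M /\
  mxderiv a b Y (fun t => c t *: (J *m (gamma t)^t* *m (gamma t *m Y t))).

(* The size of 1 / (s + i eta - t). *)
Definition cauchy_bound (a b s eta : R) (c : R -> R[i]) :=
  forall t, a <= t <= b ->
    Normc.normc (c t) * `|t - s| <= 1 /\ Normc.normc (c t) * eta <= 1.

(** The bound of [volterra_bound] without forcing term, valid on every interval of length at most
    [L]. *)
Definition volterra_const (G M L : R) := 2 * G * expR (2 * M * L).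

Lemma volterra_const_ge0 G M L : 0 <= G -> 0 <= volterra_const G M L.
Proof. by move=> G0; rewrite /volterra_const !mulr_ge0 ?expR_ge0. Qed.

Lemma kernel_boundW gamma a b a' b' G M : a <= a' -> b' <= b ->
  kernel_bound gamma a b G M -> kernel_bound gamma a' b' G M.
Proof.
move=> aa bb [h1 h2].
have sub t : a' <= t <= b' -> a <= t <= b.
  by case/andP=> h h'; rewrite (le_trans aa)//= (le_trans h').
by split=> [t /sub /h1//|x t /sub hx /sub ht]; exact: h2.
Qed.

Lemma cauchy_boundW a b a' b' s eta c : a <= a' -> b' <= b ->
  cauchy_bound a b s eta c -> cauchy_bound a' b' s eta c.
Proof.
move=> aa bb h t /andP[h1 h2]; apply: h.
by rewrite (le_trans aa)//= (le_trans h2).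
Qed.

Lemma cauchy_bound_le a b s eta c t : cauchy_bound a b s eta c -> 0 < eta ->
  a <= t <= b -> Normc.normc (c t) <= 2 / (`|t - s| + eta).
Proof.
move=> h eta0 tab; have [h1 h2] := h t tab.
rewrite ler_pdivlMr ?ltr_wpDl// mulrDr.
by rewrite (le_trans (lerD h1 h2)).
Qed.

Lemma mxl1_kernel p (D : 'M[R[i]]_(p, m)) c (g : 'M[R[i]]_(m, k))
    (U : 'M[R[i]]_(k, m)) B1 B2 :
  mxl1 (D *m J *m g) <= B1 -> mxl1 U <= B2 ->
  mxl1 (D *m (c *: (J *m g *m U))) <= Normc.normc c * B1 * B2.
Proof.
move=> h1 h2; rewrite -scalemxAr mxl1Z -mulrA ler_wpM2l ?normc_ge0//.
rewrite !mulmxA; apply: le_trans (mxl1M _ _) _.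
by apply: ler_pM; rewrite ?mxl1_ge0.
Qed.

(** Interpolation between two bounds for a kernel K against a coefficient of size 1 / sg: near the
    singularity K = O(sg) cancels the pole, away from it K is O(th). The two are added after
    multiplication by th and sg. The result integrates to th log (1 / th), free of eta. *)
Lemma small_kernel_le (c0 sg th K G M : R) :
  0 <= c0 -> 0 <= sg -> c0 * sg <= 1 -> 0 < th -> 0 <= G -> 0 <= M ->
  K <= 2 * M * sg -> K <= th * G ->
  c0 * K <= th * (G + 2 * M) / (sg + th).
Proof.
move=> c00 sg0 cs th0 G0 M0 K1 K2.
rewrite ler_pdivlMr ?ltr_wpDl// mulrDr [th * _]mulrDr lerD//.
  rewrite mulrAC; apply: le_trans (_ : c0 * sg * (th * G) <= _).
    by rewrite ler_wpM2l// mulr_ge0.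
  by rewrite ler_piMl// mulr_ge0// ltW.
rewrite mulrC ler_wpM2l ?(ltW th0)//.
apply: le_trans (ler_wpM2l c00 K1) _.
by rewrite mulrCA ler_piMr// mulr_ge0.
Qed.

Section Estimates.
Variables (gamma : R -> 'M[R[i]]_(k, m)) (G M L : R).
Hypotheses (G0 : 0 <= G) (M0 : 0 < M).

(** * Solutions up to the singularity: boundedness, growth, dependence on the height *)

Section LeftOfSingularity.
Variables (a s eta : R).
Hypotheses (as_ : a <= s) (sL : s - a <= L) (eta0 : 0 < eta).
Hypotheses (gc : mxcont a s gamma) (kb : kernel_bound gamma a s G M).

Let expL : expR (2 * M * (s - a)) <= expR (2 * M * L).
Proof. by rewrite ler_expR ler_wpM2l// mulr_ge0// ltW. Qed.

Lemma solution_left_bound c Y :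
  normalized_solution gamma a s c Y -> cauchy_bound a s s eta c ->
  forall t, a <= t <= s -> mxl1 (gamma t *m Y t) <= volterra_const G M L.
Proof.
move=> [Ya dY] hc t tas; apply: le_trans (_ : 2 * (G + 0) * expR (2 * M * (s - a)) <= _).
  apply: (@volterra_bound _ _ _ a s M G 0 (fun t => gamma t *m Y t)
    (fun x r => gamma x *m Y r)
    (fun x r => gamma x *m (c r *: (J *m (gamma r)^t* *m (gamma r *m Y r))))
    (fun=> 0) (fun=> 0)) => //.
  - by apply: mxcontM => //; exact: mxderiv_cont dY.
  - by move=> x /andP[ax xs]; apply: mxderivMl; exact: mxderivW dY.
  - by move=> x xas; rewrite Ya mulmx1; case: (kb.1 _ xas).
  move=> x r ar rx xs; rewrite addr0.
  have ras : a <= r <= s by rewrite ar (le_trans rx).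
  have xas : a <= x <= s by rewrite (le_trans ar).
  apply: le_trans (mxl1_kernel _ (kb.2 x r xas ras) (lexx _)) _.
  rewrite ler_wpM2r ?mxl1_ge0// mulrCA ler_piMr ?(ltW M0)//.
  apply: le_trans (hc _ ras).1; rewrite ler_wpM2l ?normc_ge0//.
  by rewrite [X in _ <= X]distrC !ger0_norm ?subr_ge0// ?lerD2r// (le_trans rx).
by rewrite addr0 /volterra_const ler_wpM2l// mulr_ge0.
Qed.

(** Once [gamma *m Y] is bounded, the equation bounds the derivative of [Y] by a multiple of 1 / (s
    - t + eta), whose integral is at most [lg L eta]. *)
Lemma solution_log_bound c Y :
  normalized_solution gamma a s c Y -> cauchy_bound a s s eta c ->
  forall t, a <= t <= s ->
  mxl1 (Y t) <= mxl1 (1%:M : 'M[R[i]]_m) + 2 * (G * volterra_const G M L) * lg L eta.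
Proof.
move=> hY hc t /andP[at_ ts]; have uC := solution_left_bound hY hc.
have [Ya dY] := hY.
rewrite (le_trans (mxl1_le_add _ (Y a)))// Ya lerD2l -{1}Ya.
have dYt : mxderiv a t Y (fun t => c t *: (J *m (gamma t)^t* *m (gamma t *m Y t))).
  exact: mxderivW dY.
have C0 := volterra_const_ge0 M L G0.
(* The second kernel is switched off by the coefficient 0, with 1 as a dummy width. *)
have h := @mxderiv_lg_le _ _ _ a t s L (2 * (G * volterra_const G M L)) eta 0 1 0 _ _ at_ ts sL
  eta0 ltr01 _ (lexx _) dYt.
rewrite !mul0r !addr0 in h; apply: h; first by rewrite !mulr_ge0.
move=> r /andP[ar rt]; have ras : a <= r <= s by rewrite ar (le_trans rt).
rewrite mul0r !addr0 mxl1Z mulrAC.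
apply: ler_pM; rewrite ?normc_ge0 ?mxl1_ge0//.
  apply: le_trans (cauchy_bound_le hc eta0 ras) _.
  by rewrite distrC ger0_norm// subr_ge0 (le_trans rt).
apply: le_trans (mxl1M _ _) _; apply: ler_pM; rewrite ?mxl1_ge0//.
  exact: (kb.1 _ ras).2.
exact: uC.
Qed.

(** The difference of two solutions satisfies the Volterra equation of the first, started at 0, with
    a forcing term from [c1 - c2]. The kernel supplies a factor s - r, so the forcing is of order
    eta / (s - r + eta) and integrates to eta log (1 / eta). *)
Lemma solution_cauchy c1 c2 Y1 Y2 eta1 :
  normalized_solution gamma a s c1 Y1 -> cauchy_bound a s s eta1 c1 ->
  normalized_solution gamma a s c2 Y2 -> cauchy_bound a s s eta c2 ->
  (forall r, a <= r <= s ->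
    Normc.normc (c1 r - c2 r) * (s - r) * (s - r + eta) <= 2 * eta) ->
  mxl1 (gamma s *m Y1 s - gamma s *m Y2 s) <=
    2 * (2 * M * volterra_const G M L * eta * lg L eta) * expR (2 * M * L).
Proof.
move=> [Y1a dY1] hc1 hY2 hc2 c12.
have uC := solution_left_bound hY2 hc2; have [Y2a dY2] := hY2.
have C0 := volterra_const_ge0 M L G0.
have k0 : 0 <= 2 * M * volterra_const G M L * eta by rewrite !mulr_ge0// ltW.
have L0 : 0 <= L by rewrite (le_trans _ sL)// subr_ge0.
have ss : a <= s <= s by rewrite as_ lexx.
have k1 : 0 <= 2 * M * volterra_const G M L * eta * lg L eta.
  by apply: mulr_ge0 => //; exact: lg_ge0.
apply: le_trans (_ : 2 * (0 + 2 * M * volterra_const G M L * eta * lg L eta)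
   * expR (2 * M * (s - a)) <= _); last first.
  by rewrite add0r ler_wpM2l// mulr_ge0.
refine (@volterra_bound _ _ _ a s M 0 (2 * M * volterra_const G M L * eta * lg L eta)
    (fun t => gamma t *m Y1 t - gamma t *m Y2 t)
    (fun x r => gamma x *m (Y1 r - Y2 r))
    (fun x r => gamma x *m (c1 r *: (J *m (gamma r)^t* *m (gamma r *m Y1 r))
       - c2 r *: (J *m (gamma r)^t* *m (gamma r *m Y2 r))))
    (fun r => - (2 * M * volterra_const G M L * eta) * ln (-1 * r + (s + eta)))
    (fun r => 2 * M * volterra_const G M L * eta / (s - r + eta))
  as_ M0 (lexx 0) _ _ _ _ _ _ k1 _ s ss).
- have hd : mxderiv a s (fun t => Y1 t - Y2 t) _ := mxderivB dY1 dY2.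
  have := mxcontM gc (mxderiv_cont hd).
  by under [X in mxcont _ _ X]eq_fun do rewrite mulmxBr.
- move=> x /andP[ax xs]; apply: mxderivMl; apply: mxderivB.
    exact: mxderivW dY1.
  exact: mxderivW dY2.
- by move=> x _; rewrite mulmxBr.
- by move=> x _; rewrite Y1a Y2a subrr mulmx0 mxl10.
- by move=> x /andP[_ xs]; exact: is_derive_lg.
- move=> x /andP[ax xs]; exact: increment_lg_le.
move=> x r ar rx xs.
have ras : a <= r <= s by rewrite ar (le_trans rx).
have xas : a <= x <= s by rewrite (le_trans ar).
have rs : r <= s by rewrite (le_trans rx).
have -> : gamma x *m (c1 r *: (J *m (gamma r)^t* *m (gamma r *m Y1 r))
       - c2 r *: (J *m (gamma r)^t* *m (gamma r *m Y2 r))) =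
   gamma x *m (c1 r *: (J *m (gamma r)^t* *m (gamma r *m Y1 r - gamma r *m Y2 r)))
   + gamma x *m ((c1 r - c2 r) *: (J *m (gamma r)^t* *m (gamma r *m Y2 r))).
  rewrite -mulmxDr; congr (_ *m _).
  by rewrite mulmxBr scalerBr scalerBl addrA subrK.
have kxr := kb.2 x r xas ras.
apply: le_trans (mxl1D _ _) _; apply: lerD.
  apply: le_trans (mxl1_kernel _ kxr (lexx _)) _.
  rewrite ler_wpM2r ?mxl1_ge0// mulrCA ler_piMr ?(ltW M0)//.
  apply: le_trans (hc1 _ ras).1; rewrite ler_wpM2l ?normc_ge0//.
  by rewrite [X in _ <= X]distrC !ger0_norm ?subr_ge0// lerD2r.
apply: le_trans (mxl1_kernel _ kxr (uC _ ras)) _.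
have d0 : 0 < s - r + eta by rewrite ltr_wpDl// subr_ge0.
rewrite ler_pdivlMr// ger0_norm ?subr_ge0//.
have := c12 r ras; set nc := Normc.normc _ => hh.
have nc0 : 0 <= nc by apply: normc_ge0.
apply: le_trans (_ : M * volterra_const G M L * (nc * (s - r) * (s - r + eta)) <= _).
  have -> : nc * (M * (x - r)) * volterra_const G M L * (s - r + eta) =
    M * volterra_const G M L * (nc * (x - r) * (s - r + eta)) by ring.
  rewrite ler_wpM2l ?mulr_ge0// ?(ltW M0)// ler_wpM2r ?(ltW d0)//.
  by rewrite ler_wpM2l// lerD2r.
have -> : 2 * M * volterra_const G M L * eta = M * volterra_const G M L * (2 * eta) by ring.
by rewrite ler_wpM2l// mulr_ge0// ltW.
Qed.

End LeftOfSingularity.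

(* Continuity of [gamma * Y] at the singularity, uniformly in the parameter
   [eta]: the second term, although it involves a logarithm, is small compared
   to a Poisson kernel of width [eta]. *)
Lemma solution_modulus a b s eta c Y K t th :
  a <= s -> s <= b -> b - a <= L -> 0 < eta ->
  mxcont a b gamma -> kernel_bound gamma a b G M ->
  normalized_solution gamma a b c Y -> cauchy_bound a b s eta c ->
  (forall r, s <= r <= b -> mxl1 (Y r) <= K) -> a <= t <= b ->
  0 < th -> mxl1 (gamma t - gamma s) <= th ->
  mxl1 (gamma t *m Y t - gamma s *m Y s) <=
    th * (1 + (G + 2 * M) * volterra_const G M L * lg L th)
    + `|t - s| * (M * volterra_const G M L * (1 + 2 * lg L eta) + 2 * M * G * K * lg L eta).
Proof.
move=> as_ sb bL eta0 gc kb hY hc YK /andP[at_ tb] th0 gts.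
have C0 := volterra_const_ge0 M L G0.
have ab : a <= b by rewrite (le_trans as_).
have L0 : 0 <= L by rewrite (le_trans _ bL)// subr_ge0.
have lg0 := lg_ge0 L0 eta0; have lgt := lg_ge0 L0 th0.
have sL : s - a <= L by rewrite (le_trans _ bL)// lerD2r.
have K0 : 0 <= K by rewrite (le_trans (mxl1_ge0 (Y s)))// YK// lexx.
have [Ya dY] := hY.
have uC r : a <= r <= s -> mxl1 (gamma r *m Y r) <= volterra_const G M L.
  apply: (@solution_left_bound a s eta as_ sL _ _ c).
  - exact: mxcontW gc.
  - exact: kernel_boundW kb.
  - by split=> //; exact: mxderivW dY.
  - exact: cauchy_boundW hc.
have sab : a <= s <= b by rewrite as_.
have tab : a <= t <= b by rewrite at_.
(* Two bounds for one kernel: small through the increment of [gamma], and small through vanishing on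
   the diagonal. [small_kernel_le] combines them. *)
have gK r : a <= r <= b -> mxl1 ((gamma t - gamma s) *m J *m (gamma r)^t*) <= th * G.
  move=> rab; rewrite -mulmxA; apply: le_trans (mxl1M _ _) _.
  by apply: ler_pM; rewrite ?mxl1_ge0//; exact: (kb.1 _ rab).2.
have ker2 r : a <= r <= b -> mxl1 ((gamma t - gamma s) *m J *m (gamma r)^t*) <=
    M * `|t - r| + M * `|s - r|.
  move=> rab; rewrite !mulmxBl (le_trans (mxl1B _ _))// lerD//; exact: kb.2.
have start : mxl1 ((gamma t - gamma s) *m Y a) <= th by rewrite Ya mulmx1.
have [ts|/ltW st] := leP t s.
  (* To the left of s both pieces use only times at most s, where [gamma *m Y] is bounded. In the
     second piece the kernel at [gamma s] cancels the pole exactly, which gives a Lipschitz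
     bound. *)
  have E : gamma t *m Y t - gamma s *m Y s = (gamma t - gamma s) *m Y t -
      (gamma s *m Y s - gamma s *m Y t).
    by rewrite mulmxBl opprB addrA subrK.
  rewrite E (le_trans (mxl1B _ _))// lerD//.
    rewrite (le_trans (mxl1_le_add _ ((gamma t - gamma s) *m Y a)))//.
    rewrite mulrDr mulr1 lerD//.
    have h := @mxderiv_lg_le _ _ _ a t s L (th * (G + 2 * M) * volterra_const G M L) th 0 1 0 _ _
      at_ ts sL th0 ltr01 _ (lexx _) (mxderivMl (gamma t - gamma s) (mxderivW (lexx _) tb dY)).
    rewrite !mul0r !addr0 in h.
    have -> : th * ((G + 2 * M) * volterra_const G M L * lg L th) =
      th * (G + 2 * M) * volterra_const G M L * lg L th by ring.
    apply: h.
      by rewrite !mulr_ge0 ?addr_ge0 ?mulr_ge0// ltW.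
    move=> r /andP[ar rt]; have rs : r <= s by rewrite (le_trans rt).
    have rab : a <= r <= b by rewrite ar (le_trans rs).
    have ras : a <= r <= s by rewrite ar.
    rewrite mul0r !addr0.
    apply: le_trans (mxl1_kernel _ (lexx _) (uC _ ras)) _.
    rewrite [leRHS]mulrAC ler_wpM2r// small_kernel_le ?normc_ge0 ?subr_ge0 ?(ltW M0)//.
    - by have := (hc _ rab).1; rewrite distrC ger0_norm// subr_ge0.
    - rewrite (le_trans (ker2 _ rab))// !ger0_norm ?subr_ge0//.
      have : M * (t - r) <= M * (s - r) by rewrite ler_wpM2l ?(ltW M0)// lerD2r.
      by move=> h'; rewrite -mulrA mulr_natl mulr2n lerD2r.
    - exact: gK.
  rewrite distrC ger0_norm ?subr_ge0//.
  apply: le_trans (_ : M * volterra_const G M L * (s - t) <= _).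
    apply: (mxderiv_lip (a := t) (b := s) (F := fun r => gamma s *m Y r)) => //.
      apply: mxderivMl; exact: mxderivW dY.
    move=> r /andP[tr rs].
    have rab : a <= r <= b by rewrite (le_trans at_)//= (le_trans rs).
    have ras : a <= r <= s by rewrite (le_trans at_).
    apply: le_trans (mxl1_kernel _ (kb.2 _ _ sab rab) (uC _ ras)) _.
    rewrite ler_wpM2r// mulrCA ler_piMr ?(ltW M0)//.
    by rewrite distrC; exact: (hc _ rab).1.
  rewrite mulrC ler_wpM2l ?subr_ge0// mulrDr mulr1 -addrA lerDl.
  by rewrite addr_ge0// !mulr_ge0// ltW.
(* To the right of s the increment of [gamma] is paired with [Y s], which keeps its integral on
   [a, s]. Over [s, t] only the bound [K] for [Y] is available, but there the kernel is at most M (t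
   - s). *)
have E : gamma t *m Y t - gamma s *m Y s = (gamma t - gamma s) *m Y s +
    (gamma t *m Y t - gamma t *m Y s).
  by rewrite mulmxBl [RHS]addrC addrA subrK.
rewrite E (le_trans (mxl1D _ _))//.
have h1 : mxl1 ((gamma t - gamma s) *m Y s) <=
    th * (1 + (G + 2 * M) * volterra_const G M L * lg L th)
    + (t - s) * (M * volterra_const G M L * (2 * lg L eta)).
  rewrite (le_trans (mxl1_le_add _ ((gamma t - gamma s) *m Y a)))//.
  rewrite mulrDr mulr1 -addrA lerD//.
  have h := @mxderiv_lg_le _ _ _ a s s L (th * (G + 2 * M) * volterra_const G M L) th
    (2 * M * (t - s) * volterra_const G M L) eta 0 _ _ as_ (lexx _) sL th0 eta0 _ _
    (mxderivMl (gamma t - gamma s) (mxderivW (lexx _) sb dY)).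
  rewrite !mul0r !addr0 in h.
  have -> : th * ((G + 2 * M) * volterra_const G M L * lg L th) +
      (t - s) * (M * volterra_const G M L * (2 * lg L eta)) =
    th * (G + 2 * M) * volterra_const G M L * lg L th
    + 2 * M * (t - s) * volterra_const G M L * lg L eta.
    by ring.
  apply: h.
  - by rewrite !mulr_ge0 ?addr_ge0 ?mulr_ge0// ltW.
  - by rewrite !mulr_ge0 ?subr_ge0// ltW.
  move=> r /andP[ar rs].
  have rab : a <= r <= b by rewrite ar (le_trans rs).
  have ras : a <= r <= s by rewrite ar.
  have rt : r <= t by rewrite (le_trans rs).
  rewrite !addr0.
  apply: le_trans (mxl1_kernel _ (lexx _) (uC _ ras)) _.
  set nc := Normc.normc _; set KK := mxl1 _.
  have -> : th * (G + 2 * M) * volterra_const G M L / (s - r + th) +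
    2 * M * (t - s) * volterra_const G M L / (s - r + eta) =
    (th * (G + 2 * M) / (s - r + th) + M * (t - s) * (2 / (s - r + eta))) * volterra_const G M L.
    by ring.
  rewrite ler_wpM2r//.
  (* Since M (t - r) + M (s - r) = 2 M (s - r) + M (t - s), only the excess M (t - s) fails to
     vanish at s. It alone is integrated at width eta; the rest goes through [small_kernel_le]. *)
  have -> : nc * KK = nc * (KK - M * (t - s)) + M * (t - s) * nc by ring.
  apply: lerD.
    apply: small_kernel_le; rewrite ?normc_ge0 ?subr_ge0 ?(ltW M0)//.
    - by have := (hc _ rab).1; rewrite distrC ger0_norm// subr_ge0.
    - rewrite lerBlDr (le_trans (ker2 _ rab))// !ger0_norm ?subr_ge0//.
      by rewrite le_eqVlt; apply/orP; left; apply/eqP; ring.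
    - by rewrite lerBlDr (le_trans (gK _ rab))// lerDl mulr_ge0 ?subr_ge0 ?(ltW M0).
  rewrite ler_wpM2l ?mulr_ge0 ?subr_ge0 ?(ltW M0)//.
  have := cauchy_bound_le hc eta0 rab.
  by rewrite distrC ger0_norm// subr_ge0.
have h2 : mxl1 (gamma t *m Y t - gamma t *m Y s) <= (t - s) * (2 * M * G * K * lg L eta).
  have -> : (t - s) * (2 * M * G * K * lg L eta) = 2 * M * (t - s) * G * K * lg L eta.
    by ring.
  have tsL : t - s <= L by rewrite (le_trans _ bL)// lerB.
  have := @mxderiv_lg_le_right _ _ _ s t L (2 * M * (t - s) * G * K) eta _ _ st tsL
    eta0 _ (mxderivMl (gamma t) (mxderivW as_ tb dY)); apply.
    by rewrite !mulr_ge0 ?subr_ge0// ltW.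
  move=> r /andP[sr rt].
  have rab : a <= r <= b by rewrite (le_trans as_)//= (le_trans rt).
  have uK : mxl1 (gamma r *m Y r) <= G * K.
    apply: le_trans (mxl1M _ _) _; apply: ler_pM; rewrite ?mxl1_ge0//.
      exact: (kb.1 _ rab).1.
    by apply: YK; rewrite sr (le_trans rt).
  have kk : mxl1 (gamma t *m J *m (gamma r)^t*) <= M * (t - s).
    apply: le_trans (kb.2 _ _ tab rab) _; rewrite ler_wpM2l ?(ltW M0)//.
    by rewrite ger0_norm ?subr_ge0// lerB.
  apply: le_trans (mxl1_kernel _ kk uK) _.
  have -> : 2 * M * (t - s) * G * K / (r - s + eta) =
    2 / (r - s + eta) * (M * (t - s)) * (G * K) by ring.
  rewrite ler_wpM2r ?mulr_ge0// ler_wpM2r ?mulr_ge0 ?subr_ge0 ?(ltW M0)//.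
  have := cauchy_bound_le hc eta0 rab.
  by rewrite [`|_|]ger0_norm// subr_ge0.
rewrite ger0_norm ?subr_ge0//.
apply: le_trans (lerD h1 h2) _; rewrite -addrA lerD2l -mulrDr.
rewrite ler_wpM2l ?subr_ge0// lerD2r ler_wpM2l ?mulr_ge0// ?(ltW M0)//.
by rewrite lerDr.
Qed.

End Estimates.
End SingularSystem.

(** * Limits at the real axis *)

Section Asymptotics.
Context {R : realType}.

(** With y = 1 + lg L h, the exponential of y is at most a constant over h, and y^16 <= 16! exp y,
    so h y^16 stays bounded by [Q]. The fourth power of sqrt h y^4 is h times h y^16, hence at most
    h [Q]. The square root is the cutoff distance used for the jump. *)
Lemma sqrt_lg4_small (L K e : R) : 0 <= L -> 0 <= K -> 0 < e ->
  exists2 h0, 0 < h0 <= 1 &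
  forall h, 0 < h <= h0 -> K * (Num.sqrt h * (1 + lg L h) ^+ 4) <= e.
Proof.
move=> L0 K0 e0.
have [f f0 fE] : exists2 f : R, 0 < f & forall x, 0 <= x -> x ^+ 16 <= f * expR x.
  exists (16`!)%:R; first by rewrite ltr0n fact_gt0.
  move=> x x0; have := expR_ge1Dxn 15 x0 => hx.
  rewrite -ler_pdivrMl ?ltr0n ?fact_gt0// mulrC.
  by rewrite (le_trans _ hx)// lerDr.
pose Q := f * (expR 1 * (L + 1)).
have Q0 : 0 < Q by rewrite !mulr_gt0 ?expR_gt0// ltr_wpDl.
pose d := e / (K + 1).
have d0 : 0 < d by rewrite divr_gt0// ltr_wpDl.
exists (Num.min 1 (d ^+ 4 / Q)).
  by rewrite lt_min ltr01 divr_gt0 ?exprn_gt0//= ge_min lexx.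
move=> h /andP[h0]; rewrite le_min => /andP[h1 hQ].
set y := 1 + lg L h; set X := Num.sqrt h * y ^+ 4.
have y0 : 0 <= y by rewrite addr_ge0// lg_ge0.
have X0 : 0 <= X by rewrite mulr_ge0 ?sqrtr_ge0// exprn_ge0.
have hy : h * y ^+ 16 <= Q.
  have ey : expR y <= expR 1 * ((L + 1) / h).
    rewrite /y expRD ler_wpM2l ?expR_ge0// /lg lnK; last first.
      by rewrite posrE divr_gt0// ltr_wpDl.
    by rewrite ler_pM2r ?invr_gt0// lerD2l.
  have := fE y y0; move/le_trans => /(_ (f * (expR 1 * ((L + 1) / h)))).
  move=> /(_ (ler_wpM2l (ltW f0) ey)) /(ler_wpM2l (ltW h0)) /le_trans; apply.
  rewrite /Q le_eqVlt; apply/orP; left; apply/eqP; field.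
  by rewrite gt_eqF.
have X4 : X ^+ 4 <= d ^+ 4.
  have -> : X ^+ 4 = h * (h * y ^+ 16).
    rewrite /X exprMn -exprM.
    have -> : Num.sqrt h ^+ 4 = (Num.sqrt h ^+ 2) ^+ 2 by rewrite -exprM.
    by rewrite sqr_sqrtr ?(ltW h0)//; ring.
  apply: le_trans (ler_wpM2l (ltW h0) hy) _.
  by rewrite -ler_pdivlMr.
have Xd : X <= d by rewrite -(@ler_pXn2r _ 4)// nnegrE// ltW.
apply: le_trans (ler_wpM2l K0 Xd) _.
by rewrite /d mulrCA ler_piMr ?(ltW e0)// ler_pdivrMr ?ltr_wpDl// mul1r lerDl.
Qed.

Lemma near_right0P (P : set R) : (\forall h \near 0^'+, P h) <->
  exists2 h0, 0 < h0 & forall h, 0 < h < h0 -> P h.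
Proof.
split=> [/nbhs_ballP[d /= d0 hd]|[h0 h00 hh]].
  exists d => // h /andP[hp hlt]; apply: hd => //.
  by rewrite /ball /= sub0r normrN gtr0_norm.
apply/nbhs_ballP; exists h0 => //= h; rewrite /ball /= sub0r normrN => hlt hp.
by apply: hh; rewrite hp/= -[ltLHS]gtr0_norm.
Qed.

(** The limit is pi / 2, - pi / 2 or 0 according to the sign of c; the value 0 occurs when s is an
    end point, where one half of the Poisson mass is lost. *)
Lemma atan_scaled_cvg (c : R) : exists l : R, forall e, 0 < e ->
  exists2 h0, 0 < h0 & forall h, 0 < h < h0 -> `|atan (c / h) - l| <= e.
Proof.
have pos (d : R) : 0 < d -> exists l : R, forall e, 0 < e ->
    exists2 h0, 0 < h0 & forall h, 0 < h < h0 -> `|atan (d / h) - l| <= e.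
  move=> d0; exists (pi / 2) => e e0.
  have /cvgrPdist_le /(_ e e0) [N [_ hN]] := @cvgy_atan R.
  have N0 : 0 < `|N| + 1 by rewrite ltr_wpDl.
  exists (d / (`|N| + 1)); first by rewrite divr_gt0.
  move=> h /andP[h0 hh]; rewrite distrC; apply: hN.
  rewrite ltr_pdivlMr//; rewrite ltr_pdivlMr// mulrC in hh.
  apply: le_lt_trans hh; rewrite ler_wpM2r ?(ltW h0)//.
  by rewrite (le_trans (ler_norm N))// lerDl.
have [c0|c0|->] := ltgtP c 0.
- have [|l hl] := pos (- c); first by rewrite oppr_gt0.
  exists (- l) => e /hl [h0 h00 hh]; exists h0 => // h /hh.
  by rewrite mulNr atanN -opprD normrN opprK.
- exact: pos.
- by exists 0 => e e0; exists 1 => // h _; rewrite mul0r atan0 subrr normr0 ltW.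
Qed.

(** Completeness is invoked in [R] only, for the real and imaginary parts of the finitely many
    entries. *)
Lemma mxl1_cauchy_cvg p q (F : R -> 'M[R[i]]_(p, q)) :
  (forall e, 0 < e -> exists2 h0, 0 < h0 &
    forall h1 h2, 0 < h1 -> h1 <= h2 -> h2 < h0 -> mxl1 (F h1 - F h2) <= e) ->
  exists l, forall e, 0 < e -> exists2 h0, 0 < h0 &
    forall h, 0 < h < h0 -> mxl1 (F h - l) <= e.
Proof.
move=> hF.
have cv (g : R -> R) : (forall h1 h2, `|g h1 - g h2| <= mxl1 (F h1 - F h2)) ->
    cvg (g h @[h --> 0^'+]).
  move=> hg; apply: cauchy_cvg; apply: cauchy_exP => e e0.
  have e20 : 0 < e / 2 by rewrite divr_gt0.
  have [h0 h00 hh] := hF _ e20.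
  have h20 : 0 < h0 / 2 by rewrite divr_gt0.
  have h2h : h0 / 2 < h0 by rewrite ltr_pdivrMr// ltr_pMr// ltr1n.
  exists (g (h0 / 2)).
  have : \forall h \near 0^'+, 0 < h < h0.
    near=> h; apply/andP; split => //; near: h; exact: nbhs_right_lt.
  apply: filterS => h /andP[hp hlt].
  rewrite /ball /=; apply: (@le_lt_trans _ _ (e / 2)); last first.
    by rewrite ltr_pdivrMr// ltr_pMr// ltr1n.
  apply: le_trans (hg _ _) _.
  have [hle|/ltW hle] := leP h (h0 / 2); first by rewrite mxl1_sub; exact: hh.
  exact: hh.
have ReB (x y : R[i]) : complex.Re x - complex.Re y = complex.Re (x - y).
  by case: x => ? ?; case: y.
have ImB (x y : R[i]) : complex.Im x - complex.Im y = complex.Im (x - y).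
  by case: x => ? ?; case: y.
have Rele (z : R[i]) : `|complex.Re z| <= Normc.normc z.
  case: z => x y /=; rewrite -sqrtr_sqr ler_wsqrtr//.
  by rewrite lerDl sqr_ge0.
have Imle (z : R[i]) : `|complex.Im z| <= Normc.normc z.
  case: z => x y /=; rewrite -[leLHS]sqrtr_sqr ler_wsqrtr//.
  by rewrite lerDr sqr_ge0.
have lt2 (x y : R[i]) : Normc.normc (x - y) <= `|complex.Re x - complex.Re y| +
    `|complex.Im x - complex.Im y|.
  rewrite ReB ImB; case: (x - y) => u v /=.
  rewrite -[leRHS]ger0_norm ?addr_ge0// -sqrtr_sqr ler_wsqrtr//.
  rewrite sqrrD !real_normK ?num_real// -addrA lerD2l lerDr.
  by rewrite mulrn_wge0// mulr_ge0.
pose l := \matrix_(i, j) Complex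
  (lim (complex.Re (F h i j) @[h --> (0:R)^'+])) (lim (complex.Im (F h i j) @[h --> (0:R)^'+])).
have cR i j : complex.Re (F h i j) @[h --> (0:R)^'+] --> complex.Re (l i j).
  rewrite mxE /=; apply: cv => h1 h2; rewrite ReB (le_trans (Rele _))//.
  by have := le_normc_mxl1 (F h1 - F h2) i j; rewrite !mxE.
have cI i j : complex.Im (F h i j) @[h --> (0:R)^'+] --> complex.Im (l i j).
  rewrite mxE /=; apply: cv => h1 h2; rewrite ImB (le_trans (Imle _))//.
  by have := le_normc_mxl1 (F h1 - F h2) i j; rewrite !mxE.
exists l => e e0.
pose c := e / (2 * (p * q + 1)%:R).
have c0 : 0 < c by rewrite divr_gt0// mulr_gt0// ltr0n addn1.
have : \forall h \near 0^'+, forall ij : 'I_p * 'I_q,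
    `|complex.Re (F h ij.1 ij.2) - complex.Re (l ij.1 ij.2)| <= c /\
    `|complex.Im (F h ij.1 ij.2) - complex.Im (l ij.1 ij.2)| <= c.
  apply: filter_forall => -[i j] /=.
  have /cvgrPdist_le /(_ c c0) h1 := cR i j.
  have /cvgrPdist_le /(_ c c0) h2 := cI i j.
  near=> h; split; rewrite distrC; near: h; [exact: h1|exact: h2].
move=> /near_right0P[h0 h00 hh]; exists h0 => // h /hh {}hh.
apply: le_trans (_ : (p * q)%:R * (c + c) <= _).
  apply: mxl1_le => i j; have [h1 h2] := hh (i, j).
  rewrite !mxE; apply: le_trans (lt2 _ _) _; apply: lerD.
    by move: h1; rewrite /= mxE.
  by move: h2; rewrite /= mxE.
have -> : c + c = e / (p * q + 1)%:R.
  have n0 : (p * q + 1)%:R != 0 :> R by rewrite pnatr_eq0 addn1.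
  by rewrite /c; move: (p * q + 1)%:R n0 => N N0; field.
rewrite mulrCA ler_piMr ?(ltW e0)// ler_pdivrMr ?ltr0n ?addn1//.
by rewrite mul1r ler_nat leqW.
Unshelve. all: by end_near.
Qed.

(** * The coefficient i / (z - t) and its real part *)

Definition cauchy_coef (z : R[i]) (t : R) : R[i] := 'i%C / (z - t%:C).

Lemma cauchy_coefE (s sg t : R) :
  cauchy_coef (s +i* sg) t = (sg / ((t - s) ^+ 2 + sg ^+ 2)) +i*
    ((s - t) / ((t - s) ^+ 2 + sg ^+ 2)).
Proof.
rewrite /cauchy_coef.
have -> : (s +i* sg) - t%:C = (s - t) +i* sg :> R[i].
  by apply/eqP; rewrite eq_complex /= subr0 !eqxx.
have -> : (t - s) ^+ 2 = (s - t) ^+ 2 by rewrite -sqrrN opprB.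
by apply/eqP; rewrite eq_complex /=; apply/andP; split; apply/eqP; ring.
Qed.

(** This skew symmetry makes the J-form of the solutions at conjugate parameters constant. *)
Lemma conj_cauchy_coef (s sg t : R) :
  Num.conj (cauchy_coef (s +i* sg) t) = - cauchy_coef (s +i* (- sg)) t.
Proof.
rewrite !cauchy_coefE sqrrN; apply/eqP; rewrite eq_complex /=.
by apply/andP; split; apply/eqP; ring.
Qed.

(** At equal parameters the derivative of the J-form carries this factor: it is the source of the
    Poisson kernel. *)
Lemma conj_add_cauchy_coef (s sg t : R) :
  Num.conj (cauchy_coef (s +i* sg) t) + cauchy_coef (s +i* sg) t =
  (2 * sg / ((t - s) ^+ 2 + sg ^+ 2))%:C.
Proof.
rewrite !cauchy_coefE; apply/eqP; rewrite eq_complex /=.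
by apply/andP; split; apply/eqP; ring.
Qed.

Lemma normc_sub_real (s sg t : R) :
  Normc.normc ((s +i* sg) - t%:C) = Num.sqrt ((t - s) ^+ 2 + sg ^+ 2).
Proof. by rewrite /= subr0 -[(s - t) ^+ 2]sqrrN opprB. Qed.

Lemma le_dist_sqrt (x y : R) : `|x| <= Num.sqrt (x ^+ 2 + y ^+ 2).
Proof. by rewrite -sqrtr_sqr ler_wsqrtr// lerDl sqr_ge0. Qed.

Lemma le_height_sqrt (x y : R) : `|y| <= Num.sqrt (x ^+ 2 + y ^+ 2).
Proof. by rewrite -sqrtr_sqr ler_wsqrtr// lerDr sqr_ge0. Qed.

Lemma normc_cauchy_coef (s sg t : R) :
  Normc.normc (cauchy_coef (s +i* sg) t) =
  (Num.sqrt ((t - s) ^+ 2 + sg ^+ 2))^-1.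
Proof.
rewrite Normc.normcM Normc.normcV normc_sub_real /= expr0n add0r expr1n.
by rewrite sqrtr1 mul1r.
Qed.

Lemma cauchy_coef_bound (a b s sg : R) : sg != 0 ->
  cauchy_bound a b s `|sg| (cauchy_coef (s +i* sg)).
Proof.
move=> sg0 t _; rewrite normc_cauchy_coef.
have n0 : 0 < Num.sqrt ((t - s) ^+ 2 + sg ^+ 2).
  by rewrite (lt_le_trans _ (le_height_sqrt _ _))// normr_gt0.
by rewrite !ler_pdivrMl// mulr1 le_dist_sqrt le_height_sqrt.
Qed.

(** The difference is - (h2 - h1) / ((z1 - t) (z2 - t)), where |t - s| <= |z1 - t| and |t - s| + h2
    <= 2 |z2 - t|. *)
Lemma cauchy_coef_sub (s h1 h2 t : R) : 0 < h1 -> h1 <= h2 ->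
  Normc.normc (cauchy_coef (s +i* h1) t - cauchy_coef (s +i* h2) t) * `|t - s|
    * (`|t - s| + h2) <= 2 * h2.
Proof.
move=> h10 h12; have h20 : 0 < h2 by rewrite (lt_le_trans h10).
have z0 h : 0 < h -> (s +i* h) - t%:C != 0 :> R[i].
  by move=> h0; rewrite eq_complex /= negb_and subr0 (gt_eqF h0) orbT.
have -> : cauchy_coef (s +i* h1) t - cauchy_coef (s +i* h2) t =
    - (h2 - h1)%:C / (((s +i* h1) - t%:C) * ((s +i* h2) - t%:C)).
  have E : 'i%C * ((s +i* h2) - (s +i* h1)) = - (h2 - h1)%:C :> R[i].
    by apply/eqP; rewrite eq_complex /=; apply/andP; split; apply/eqP; ring.
  rewrite -E /cauchy_coef; field.
  by rewrite !z0.
rewrite Normc.normcM Normc.normcV Normc.normcM !normc_sub_real normcN normc_real.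
set n1 := Num.sqrt _; set n2 := Num.sqrt _.
have n10 : 0 < n1 by rewrite (lt_le_trans _ (le_height_sqrt _ _))// normr_gt0 gt_eqF.
have n20 : 0 < n2 by rewrite (lt_le_trans _ (le_height_sqrt _ _))// normr_gt0 gt_eqF.
rewrite invfM ger0_norm ?subr_ge0//.
have i1 : n1^-1 * `|t - s| <= 1 by rewrite ler_pdivrMl// mulr1 le_dist_sqrt.
have i2 : n2^-1 * (`|t - s| + h2) <= 2.
  rewrite ler_pdivrMl// mulrC mulr_natl mulr2n lerD ?le_dist_sqrt//.
  by rewrite -[leLHS]gtr0_norm// le_height_sqrt.
have -> : (h2 - h1) * (n1^-1 * n2^-1) * `|t - s| * (`|t - s| + h2) =
   (h2 - h1) * ((n1^-1 * `|t - s|) * (n2^-1 * (`|t - s| + h2))) by ring.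
rewrite mulrC; apply: ler_pM; rewrite ?subr_ge0//.
- by rewrite !mulr_ge0 ?invr_ge0 ?addr_ge0// ltW.
- rewrite -[leRHS]mul1r; apply: ler_pM => //.
    by rewrite mulr_ge0// invr_ge0 ltW.
  by rewrite mulr_ge0 ?invr_ge0 ?addr_ge0// ltW.
- by rewrite lerBlDr lerDl ltW.
Qed.

End Asymptotics.

(** * The jump of the fundamental solution *)

Section Jump.
Context {R : realType}.
Variables (k m : nat) (J : 'M[R[i]]_m).
Hypotheses (JJ : J *m J = 1%:M) (Jadj : J^t* = J).

(** Both factors J of the two equations cancel against the J of the form. The lemma serves twice: at
    conjugate parameters it yields the inverse of W, at equal parameters the integrand of the
    jump. *)
Lemma mxderiv_form (a b : R) (gamma : R -> 'M[R[i]]_(k, m)) (c1 c2 : R -> R[i])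
    (Y1 Y2 : R -> 'M[R[i]]_m) :
  mxderiv a b Y1 (fun t => c1 t *: (J *m (gamma t)^t* *m (gamma t *m Y1 t))) ->
  mxderiv a b Y2 (fun t => c2 t *: (J *m (gamma t)^t* *m (gamma t *m Y2 t))) ->
  mxderiv a b (fun t => (Y2 t)^t* *m (J *m Y1 t)) (fun t =>
    (Num.conj (c2 t) + c1 t) *: ((gamma t *m Y2 t)^t* *m (gamma t *m Y1 t))).
Proof.
move=> d1 d2; have := mxderivM (mxderiv_adj d2) (mxderivMl J d1).
apply: eq_mxderiv => // t _; rewrite adjmxZ scalerDl.
congr (_ + _).
  rewrite -scalemxAl; congr (_ *: _).
  rewrite !adjmxM adjmxK Jadj -!mulmxA; do 3 congr (_ *m _).
  by rewrite mulmxA JJ mul1mx.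
rewrite -!scalemxAr; congr (_ *: _).
by rewrite !adjmxM !mulmxA -[_ *m J *m J]mulmxA JJ mulmx1.
Qed.

Variables (gamma : R -> 'M[R[i]]_(k, m)) (a b G M : R).
Hypotheses (ab : a <= b) (G0 : 0 <= G) (M0 : 0 < M).
Hypotheses (gc : mxcont a b gamma) (kb : kernel_bound J gamma a b G M).
Variable W : R[i] -> R -> 'M[R[i]]_m.
Hypothesis hW : forall s sg : R, sg != 0 ->
  normalized_solution J gamma a b (cauchy_coef (s +i* sg)) (W (s +i* sg)).

Local Notation L := (b - a).
Local Notation C := (volterra_const G M L).

Let L0 : 0 <= L. Proof. by rewrite subr_ge0. Qed.
Let C0 : 0 <= C. Proof. exact: volterra_const_ge0. Qed.

(** An inverse built from the conjugate parameter, so that bounds for W are at once bounds for its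
    inverse. *)
Definition Winv (s sg x : R) : 'M[R[i]]_m :=
  J *m (W (s +i* (- sg)) x)^t* *m J.

Lemma solution_form s sg t : sg != 0 -> a <= t <= b ->
  (W (s +i* (- sg)) t)^t* *m (J *m W (s +i* sg) t) = J.
Proof.
move=> sg0 tab; have [W1a dW1] := hW s sg0.
have sgN : - sg != 0 by rewrite oppr_eq0.
have [W2a dW2] := hW s sgN.
have d : mxderiv a b (fun t => (W (s +i* (- sg)) t)^t* *m (J *m W (s +i* sg) t)) (fun=> 0).
  apply: eq_mxderiv (mxderiv_form dW1 dW2) => // r _.
  by rewrite conj_cauchy_coef opprK addNr scale0r.
by rewrite (mxderiv0_const d tab) W1a W2a mulmx1 adjmx1 mul1mx.
Qed.

Lemma WinvW s sg t : sg != 0 -> a <= t <= b ->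
  Winv s sg t *m W (s +i* sg) t = 1%:M.
Proof. by move=> sg0 tab; rewrite /Winv -!mulmxA solution_form. Qed.

Lemma WWinv s sg t : sg != 0 -> a <= t <= b ->
  W (s +i* sg) t *m Winv s sg t = 1%:M.
Proof. by move=> sg0 tab; apply: mulmx1C; exact: WinvW. Qed.

(* Reversing the direction of the variable turns the right fundamental
   solution W(t) W(x)^-1 into a left one, for the singularity at [- s]. *)
Definition mirror (s sg x tau : R) : 'M[R[i]]_m :=
  W (s +i* sg) (- tau) *m Winv s sg x.

Lemma mirror_solution s sg x : sg != 0 -> a <= x <= b ->
  normalized_solution J (fun tau => gamma (- tau)) (- x) (- a)
    (fun tau => - cauchy_coef (s +i* sg) (- tau)) (mirror s sg x).
Proof.
move=> sg0 /[dup] xab /andP[ax xb]; have [Wa dW] := hW s sg0; split.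
  by rewrite /mirror opprK WWinv.
have := mxderivMr (Winv s sg x) (mxderiv_opp (mxderivW (lexx _) xb dW)).
apply: eq_mxderiv => // t _.
by rewrite mulNmx -scalemxAl scaleNr /mirror !mulmxA.
Qed.

Lemma mirror_kernel_bound : kernel_bound J (fun tau => gamma (- tau)) (- b) (- a) G M.
Proof.
have opp (x : R) : - b <= x <= - a -> a <= - x <= b.
  by rewrite lerNl lerNr andbC.
split=> [t /opp /kb.1//|x t /opp hx /opp ht].
by have := kb.2 _ _ hx ht; rewrite -opprD normrN.
Qed.

Lemma mirror_cauchy_bound (s sg x : R) : sg != 0 ->
  cauchy_bound (- x) (- a) (- s) `|sg| (fun tau => - cauchy_coef (s +i* sg) (- tau)).
Proof.
move=> sg0 t /andP[h1 h2]; rewrite normcN.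
have -> : `|t - - s| = `|- t - s| by rewrite -normrN opprD opprK.
by apply: (cauchy_coef_bound (a := a) (b := x)) => //; apply/andP; split; lra.
Qed.

(** The added 1 makes this at least 1, so lower powers are absorbed by higher ones. *)
Definition ylog (h : R) := 1 + lg L h.
Definition log_const := mxl1 (1%:M : 'M[R[i]]_m) + 2 * (G * C).

Lemma ylog_ge1 h : 0 < h -> 1 <= ylog h.
Proof. by move=> h0; rewrite lerDl lg_ge0. Qed.

Lemma log_const_ge0 : 0 <= log_const.
Proof. by rewrite addr_ge0 ?mxl1_ge0// !mulr_ge0. Qed.

Lemma log_bound_ylog h X : 0 < h ->
  X <= mxl1 (1%:M : 'M[R[i]]_m) + 2 * (G * C) * lg L h -> X <= log_const * ylog h.
Proof.
move=> h0 /le_trans; apply; rewrite /log_const /ylog.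
have := mxl1_ge0 (1%:M : 'M[R[i]]_m); have := lg_ge0 L0 h0.
have : 0 <= 2 * (G * C) by rewrite !mulr_ge0.
move: (2 * (G * C)) (lg L h) (mxl1 _) => u v w u0 v0 w0.
rewrite -subr_ge0.
have -> : (w + u) * (1 + v) - (w + u * v) = u + w * v by ring.
by rewrite addr_ge0// mulr_ge0.
Qed.

(** * Growth of the solution before and beyond the singularity *)

Section AtSingularity.
Variables (s x : R).
Hypotheses (as_ : a <= s) (sx : s <= x) (xb : x <= b).

Let sb : s <= b. Proof. exact: le_trans xb. Qed.
Let ax : a <= x. Proof. exact: le_trans sx. Qed.
Let xab : a <= x <= b. Proof. by rewrite ax. Qed.
Let sab : a <= s <= b. Proof. by rewrite as_. Qed.
Let sL : s - a <= L. Proof. by rewrite lerD2r. Qed.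
Let xL : x - a <= L. Proof. by rewrite lerD2r. Qed.

Let sol_left sg : sg != 0 ->
  normalized_solution J gamma a s (cauchy_coef (s +i* sg)) (W (s +i* sg)).
Proof. by move=> /(hW s) [h1 h2]; split => //; exact: mxderivW h2. Qed.

Let mir_left sg : sg != 0 ->
  normalized_solution J (fun tau => gamma (- tau)) (- x) (- s)
    (fun tau => - cauchy_coef (s +i* sg) (- tau)) (mirror s sg x).
Proof.
move=> sg0; have [h1 h2] := mirror_solution s sg0 xab; split => //.
by apply: mxderivW h2; rewrite ?lerN2.
Qed.

Let kb_left : kernel_bound J gamma a s G M.
Proof. exact: kernel_boundW kb. Qed.

Let gc_left : mxcont a s gamma. Proof. exact: mxcontW gc. Qed.

Let mkb : kernel_bound J (fun tau => gamma (- tau)) (- x) (- s) G M.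
Proof. by apply: kernel_boundW mirror_kernel_bound; rewrite lerN2. Qed.

Let mgc : mxcont (- x) (- s) (fun tau => gamma (- tau)).
Proof. by apply: mxcontW (mxcont_opp gc); rewrite lerN2. Qed.

Let mcb sg : sg != 0 -> cauchy_bound (- x) (- s) (- s) `|sg|
  (fun tau => - cauchy_coef (s +i* sg) (- tau)).
Proof. by move=> sg0; apply: cauchy_boundW (@mirror_cauchy_bound s sg x sg0); rewrite ?lerN2. Qed.

Let Nxs : - x <= - s. Proof. by rewrite lerN2. Qed.
Let NxsL : - s - - x <= L. Proof. by rewrite opprK addrC lerB. Qed.

Lemma W_left sg t : sg != 0 -> a <= t <= s ->
  mxl1 (W (s +i* sg) t) <= log_const * ylog `|sg|.
Proof.
move=> sg0 tas; apply: log_bound_ylog; first by rewrite normr_gt0.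
apply: (solution_log_bound G0 M0 as_ sL _ gc_left kb_left (sol_left sg0)) => //.
  by rewrite normr_gt0.
exact: cauchy_coef_bound.
Qed.

Lemma mirror_left sg : sg != 0 -> mxl1 (mirror s sg x (- s)) <= log_const * ylog `|sg|.
Proof.
move=> sg0; apply: log_bound_ylog; first by rewrite normr_gt0.
apply: (solution_log_bound G0 M0 Nxs NxsL _ mgc mkb (mir_left sg0)).
- by rewrite normr_gt0.
- exact: mcb.
- by rewrite Nxs lexx.
Qed.

(** Beyond s, W(x) is the transition W(x) W(s)^-1 times W(s). The transition is, up to adjoint and
    factors J, the reversed solution at the conjugate parameter, taken at s; each factor costs one
    logarithm. *)
Lemma W_right sg : sg != 0 ->
  mxl1 (W (s +i* sg) x) <= mxl1 J ^+ 2 * log_const ^+ 2 * ylog `|sg| ^+ 2.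
Proof.
move=> sg0; have sgN : - sg != 0 by rewrite oppr_eq0.
have -> : W (s +i* sg) x =
    J *m (mirror s (- sg) x (- s))^t* *m J *m W (s +i* sg) s.
  rewrite /mirror /Winv !opprK !adjmxM adjmxK Jadj.
  rewrite !mulmxA JJ mul1mx -!mulmxA.
  have := WinvW s sg0 sab; rewrite /Winv -!mulmxA => ->.
  by rewrite mulmx1.
have hm := mirror_left sgN; rewrite normrN in hm.
have hw : mxl1 (W (s +i* sg) s) <= log_const * ylog `|sg|.
  by apply: W_left => //; rewrite as_ lexx.
have -> : mxl1 J ^+ 2 * log_const ^+ 2 * ylog `|sg| ^+ 2 =
   mxl1 J * (log_const * ylog `|sg|) * mxl1 J * (log_const * ylog `|sg|) by ring.
do 3 (apply: le_trans (mxl1M _ _) _; apply: ler_pM; rewrite ?mxl1_ge0//).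
by rewrite mxl1_adj.
Qed.

End AtSingularity.

(** The first summand comes from W to the right of s, of order [ylog] squared, the second from
    [mirror] to the left of s, of order [ylog] cubed; one constant with the cube serves both. *)
Definition growth_const := mxl1 J ^+ 2 * log_const ^+ 2 + mxl1 J ^+ 4 * log_const ^+ 3.
(** Collects the coefficients of |t - s| in [solution_modulus]; the cube from the growth bound meets
    one more logarithm there, hence the fourth power of [ylog]. *)
Definition modulus_const := 2 * M * C + 2 * M * G * growth_const.

Lemma growth_const_ge0 : 0 <= growth_const.
Proof. by rewrite addr_ge0// mulr_ge0 ?exprn_ge0 ?mxl1_ge0 ?log_const_ge0. Qed.

Lemma modulus_const_ge0 : 0 <= modulus_const.
Proof. by rewrite addr_ge0// !mulr_ge0 ?growth_const_ge0 ?(ltW M0). Qed.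

Definition modulus (th : R) := th * (1 + (G + 2 * M) * C * lg L th).

Lemma modulus_le h th d X : 0 < h -> 0 <= d ->
  X <= th * (1 + (G + 2 * M) * C * lg L th)
    + d * (M * C * (1 + 2 * lg L h) + 2 * M * G * (growth_const * ylog h ^+ 3) * lg L h) ->
  X <= modulus th + d * (modulus_const * ylog h ^+ 4).
Proof.
move=> h0 d0 /le_trans; apply; rewrite lerD2l ler_wpM2l//.
have y1 := ylog_ge1 h0; rewrite /modulus_const [leRHS]mulrDl.
have lE : lg L h = ylog h - 1 by rewrite /ylog addrAC subrr add0r.
have MC : 0 <= M * C by rewrite mulr_ge0// ltW.
have MG : 0 <= 2 * M * G * growth_const by rewrite !mulr_ge0 ?growth_const_ge0 ?(ltW M0).
have y0 : 0 <= ylog h by rewrite (le_trans _ y1).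
have y4 : ylog h <= ylog h ^+ 4 by rewrite ler_eXnr.
apply: lerD.
  have -> : 2 * M * C * ylog h ^+ 4 = M * C * (2 * ylog h ^+ 4) by ring.
  by rewrite ler_wpM2l// lE; lra.
have -> : 2 * M * G * (growth_const * ylog h ^+ 3) * lg L h =
    2 * M * G * growth_const * (ylog h ^+ 3 * lg L h).
  by ring.
rewrite ler_wpM2l// [leRHS]exprSr ler_wpM2l ?exprn_ge0// lE.
by rewrite lerBlDr lerDl.
Qed.

(** * The two factors of the jump density and the limit of the jump *)

Section UV.
Variables (s x : R).
Hypotheses (as_ : a <= s) (sx : s <= x) (xb : x <= b).

Let sb : s <= b. Proof. exact: le_trans xb. Qed.
Let ax : a <= x. Proof. exact: le_trans sx. Qed.
Let xab : a <= x <= b. Proof. by rewrite ax. Qed.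
Let sab : a <= s <= b. Proof. by rewrite as_. Qed.
Let sL : s - a <= L. Proof. by rewrite lerD2r. Qed.
Let xL : x - a <= L. Proof. by rewrite lerD2r. Qed.

Definition usol (h t : R) := gamma t *m W (s +i* h) t.
(** This is gamma(t) W(t) W(x)^-1, so that J times its adjoint is the function v of the overview. *)
Definition vsol (h t : R) := gamma t *m mirror s h x (- t).

Lemma usol_bound h t : 0 < h -> a <= t <= s -> mxl1 (usol h t) <= C.
Proof.
move=> h0; have hn0 : h != 0 by rewrite gt_eqF.
have [Wa dW] := hW s hn0.
apply: (@solution_left_bound _ _ _ J gamma G M L G0 M0 a s h as_ sL _ _
  (cauchy_coef (s +i* h))).
- exact: mxcontW gc.
- exact: kernel_boundW kb.
- by split => //; exact: mxderivW dW.
- by have := @cauchy_coef_bound R a s s h hn0; rewrite gtr0_norm.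
Qed.

Lemma vsol_bound h t : 0 < h -> s <= t <= x -> mxl1 (vsol h t) <= C.
Proof.
move=> h0 /andP[st tx]; have hn0 : h != 0 by rewrite gt_eqF.
have [Wa dW] := mirror_solution s hn0 xab.
have Nxs : - x <= - s by rewrite lerN2.
have NxsL : - s - - x <= L by rewrite opprK addrC lerB.
have := @solution_left_bound _ _ _ J (fun tau => gamma (- tau)) G M L G0 M0
  (- x) (- s) h Nxs NxsL _ _ (fun tau => - cauchy_coef (s +i* h) (- tau))
  (mirror s h x) _ _ (- t).
rewrite /vsol opprK; apply.
- by apply: mxcontW (mxcont_opp gc); rewrite lerN2.
- by apply: kernel_boundW mirror_kernel_bound; rewrite lerN2.
- by split => //; apply: mxderivW dW; rewrite ?lerN2.
- have := @mirror_cauchy_bound s h x hn0; rewrite gtr0_norm//.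
  by apply: cauchy_boundW; rewrite ?lerN2.
- by rewrite !lerN2 tx.
Qed.

Lemma usol_modulus h t th : 0 < h -> a <= t <= x -> 0 < th ->
  mxl1 (gamma t - gamma s) <= th ->
  mxl1 (usol h t - usol h s) <= modulus th + `|t - s| * (modulus_const * ylog h ^+ 4).
Proof.
move=> h0 tax th0 gts; have hn0 : h != 0 by rewrite gt_eqF.
have [Wa dW] := hW s hn0.
apply: modulus_le => //.
apply: (@solution_modulus _ _ _ J gamma G M L G0 M0 a x s h
  (cauchy_coef (s +i* h)) (W (s +i* h))) => //.
- exact: mxcontW gc.
- exact: kernel_boundW kb.
- by split => //; exact: mxderivW dW.
- by have := @cauchy_coef_bound R a x s h hn0; rewrite gtr0_norm.
move=> r /andP[sr rx].
have := W_right as_ sr (le_trans rx xb) hn0; rewrite gtr0_norm// => /le_trans; apply.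
have y1 := ylog_ge1 h0; have y0 : 0 <= ylog h by rewrite (le_trans _ y1).
have q0 := log_const_ge0; have j0 := mxl1_ge0 J.
apply: ler_pM; rewrite ?mulr_ge0 ?exprn_ge0//.
  by rewrite lerDl mulr_ge0// exprn_ge0.
(* The square of [ylog] is raised to the cube, to share one bound with [vsol]. *)
by rewrite ler_weXn2l.
Qed.

Lemma vsol_modulus h t th : 0 < h -> a <= t <= x -> 0 < th ->
  mxl1 (gamma t - gamma s) <= th ->
  mxl1 (vsol h t - vsol h s) <= modulus th + `|t - s| * (modulus_const * ylog h ^+ 4).
Proof.
move=> h0 /andP[at_ tx] th0 gts; have hn0 : h != 0 by rewrite gt_eqF.
have Nxs : - x <= - s by rewrite lerN2.
have Nsa : - s <= - a by rewrite lerN2.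
have NxL : - a - - x <= L by rewrite opprK addrC.
apply: modulus_le => //.
have := @solution_modulus _ _ _ J (fun tau => gamma (- tau)) G M L G0 M0
  (- x) (- a) (- s) h (fun tau => - cauchy_coef (s +i* h) (- tau))
  (mirror s h x) (growth_const * ylog h ^+ 3) (- t) th Nxs Nsa NxL h0.
have -> : `|- t - - s| = `|t - s| by rewrite -opprD normrN.
rewrite /vsol !opprK; apply => //.
- by apply: mxcontW (mxcont_opp gc); rewrite ?lerN2.
- by apply: kernel_boundW mirror_kernel_bound; rewrite ?lerN2.
- exact: mirror_solution.
- by have := @mirror_cauchy_bound s h x hn0; rewrite gtr0_norm.
- move=> r /andP[sr ra].
  (* The mirrored time r corresponds to a time before s. There [mirror] is W, with one logarithm,
     times the inverse of W(x), with two by [W_right] at the conjugate parameter. *)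
  have h1 : mxl1 (W (s +i* h) (- r)) <= log_const * ylog h.
    have := @W_left s x as_ sx xb h (- r) hn0; rewrite gtr0_norm//; apply.
    by apply/andP; split; lra.
  have h2 : mxl1 (W (s +i* (- h)) x) <= mxl1 J ^+ 2 * log_const ^+ 2 * ylog h ^+ 2.
    have := @W_right s x as_ sx xb (- h); rewrite oppr_eq0 normrN gtr0_norm//.
    exact.
  have y1 := ylog_ge1 h0; have y0 : 0 <= ylog h by rewrite (le_trans _ y1).
  have q0 := log_const_ge0; have j0 := mxl1_ge0 J.
  apply: le_trans (_ : mxl1 J ^+ 4 * log_const ^+ 3 * ylog h ^+ 3 <= _); last first.
    by rewrite ler_wpM2r ?exprn_ge0// lerDr mulr_ge0// exprn_ge0.
  have -> : mxl1 J ^+ 4 * log_const ^+ 3 * ylog h ^+ 3 =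
    log_const * ylog h * (mxl1 J * (mxl1 J ^+ 2 * log_const ^+ 2 * ylog h ^+ 2) * mxl1 J) by ring.
  rewrite /mirror /Winv.
  apply: le_trans (mxl1M _ _) _; apply: ler_pM; rewrite ?mxl1_ge0//.
  do 2 (apply: le_trans (mxl1M _ _) _; apply: ler_pM; rewrite ?mxl1_ge0//).
  by rewrite mxl1_adj.
- by rewrite !lerN2 tx at_.
Qed.

Definition density (h t : R) : 'M[R[i]]_m := J *m (vsol h t)^t* *m usol h t.

Definition poisson_mass (h t : R) := 2 * atan ((t - s) / h).

Lemma mxl1_form (X Y : 'M[R[i]]_(k, m)) :
  mxl1 (J *m X^t* *m Y) <= mxl1 J * mxl1 X * mxl1 Y.
Proof.
do 2 (apply: le_trans (mxl1M _ _) _; apply: ler_pM; rewrite ?mxl1_ge0//).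
by rewrite mxl1_adj.
Qed.

(** To the left of s only [usol] is bounded uniformly in h, to the right only [vsol]. This splitting
    evaluates [Y] away from s and [form_subr] evaluates [X] there; each is used on its own side. *)
Lemma form_subl (X X' Y Y' : 'M[R[i]]_(k, m)) :
  J *m X^t* *m Y - J *m X'^t* *m Y' =
  J *m (X - X')^t* *m Y + J *m X'^t* *m (Y - Y').
Proof.
have -> : J *m (X - X')^t* = J *m X^t* - J *m X'^t*.
  by rewrite (adjmxB X X') mulmxBr.
move: (J *m X^t*) (J *m X'^t*) => A B.
by rewrite (mulmxBl A B Y) (mulmxBr B Y Y') addrA subrK.
Qed.

Lemma form_subr (X X' Y Y' : 'M[R[i]]_(k, m)) :
  J *m X^t* *m Y - J *m X'^t* *m Y' =
  J *m (X - X')^t* *m Y' + J *m X^t* *m (Y - Y').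
Proof.
have -> : J *m (X - X')^t* = J *m X^t* - J *m X'^t*.
  by rewrite (adjmxB X X') mulmxBr.
move: (J *m X^t*) (J *m X'^t*) => A B.
by rewrite (mulmxBl A B Y') (mulmxBr A Y Y') [RHS]addrC addrA subrK.
Qed.

Lemma decompose_scaled (D X Y : 'M[R[i]]_m) (u v : R) :
  D - v%:C *: Y = (D - u%:C *: X) + (u - v)%:C *: X + v%:C *: (X - Y).
Proof.
have -> : (u - v)%:C = u%:C - v%:C :> R[i] by exact: rmorphB.
by apply/matrixP => i j; rewrite !mxE; ring.
Qed.

Lemma density_bound h : 0 < h -> mxl1 (density h s) <= mxl1 J * C * C.
Proof.
move=> h0; apply: le_trans (mxl1_form _ _) _.
apply: ler_pM; rewrite ?mulr_ge0 ?mxl1_ge0//.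
  by rewrite ler_wpM2l ?mxl1_ge0// vsol_bound// lexx.
by rewrite usol_bound// as_ lexx.
Qed.

Lemma density_sub h t th : 0 < h -> a <= t <= x -> 0 < th ->
  mxl1 (gamma t - gamma s) <= th ->
  mxl1 (density h t - density h s) <=
    2 * mxl1 J * C * (modulus th + `|t - s| * (modulus_const * ylog h ^+ 4)).
Proof.
move=> h0 /[dup] tax /andP[at_ tx] th0 gts.
have dU := usol_modulus h0 tax th0 gts; have dV := vsol_modulus h0 tax th0 gts.
move: (modulus th + _) dU dV => D dU dV.
have D0 : 0 <= D by rewrite (le_trans (mxl1_ge0 _) dU).
have j0 := mxl1_ge0 J.
have -> : 2 * mxl1 J * C * D = mxl1 J * D * C + mxl1 J * C * D by ring.
have [ts|/ltW st] := leP t s.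
  have -> : density h t - density h s = J *m (vsol h t - vsol h s)^t* *m usol h t +
      J *m (vsol h s)^t* *m (usol h t - usol h s).
    exact: form_subl.
  apply: le_trans (mxl1D _ _) _; apply: lerD; apply: le_trans (mxl1_form _ _) _.
    apply: ler_pM; rewrite ?mulr_ge0 ?mxl1_ge0//; first by rewrite ler_wpM2l.
    by rewrite usol_bound// at_.
  apply: ler_pM; rewrite ?mulr_ge0 ?mxl1_ge0//.
  by rewrite ler_wpM2l// vsol_bound// lexx.
have -> : density h t - density h s = J *m (vsol h t - vsol h s)^t* *m usol h s +
    J *m (vsol h t)^t* *m (usol h t - usol h s).
  exact: form_subr.
apply: le_trans (mxl1D _ _) _; apply: lerD; apply: le_trans (mxl1_form _ _) _.
  apply: ler_pM; rewrite ?mulr_ge0 ?mxl1_ge0//; first by rewrite ler_wpM2l.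
  by rewrite usol_bound// as_ lexx.
apply: ler_pM; rewrite ?mulr_ge0 ?mxl1_ge0//.
by rewrite ler_wpM2l// vsol_bound// st.
Qed.

Lemma is_derive_poisson_mass (h t : R) : 0 < h ->
  is_derive t 1 (poisson_mass h) (2 * h / ((t - s) ^+ 2 + h ^+ 2)).
Proof.
move=> h0; have hn0 : h != 0 by rewrite gt_eqF.
pose g (t : R) := h^-1 * t + - (s / h).
have gE (u : R) : g u = (u - s) / h by rewrite /g mulrBl mulrC.
have d1 : is_derive t 1 g h^-1.
  have := is_deriveD (is_derive_cmul h^-1 t) (is_derive_cst (- (s / h)) t (1 : R)).
  by rewrite addr0.
have d2 := @is_derive1_comp R (@atan R) g t _ _ (is_derive1_atan (g t)) d1.
have := is_deriveZ 2 d2.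
have -> : 2 \*: (atan \o g) = poisson_mass h.
  by apply/funext => u; rewrite /poisson_mass /= gE.
rewrite (_ : _ *: _ = 2 * h / ((t - s) ^+ 2 + h ^+ 2))//.
rewrite /GRing.scale /= gE.
have n0 : (t - s) ^+ 2 + h ^+ 2 != 0.
  by rewrite gt_eqF// ltr_wpDl ?sqr_ge0// exprn_gt0.
have -> : 1 + ((t - s) / h) ^+ 2 = ((t - s) ^+ 2 + h ^+ 2) / h ^+ 2.
  by field.
rewrite invf_div.
by field; rewrite n0 hn0.
Qed.

Lemma poisson_mass_le h t t' : poisson_mass h t - poisson_mass h t' <= 2 * pi.
Proof.
rewrite /poisson_mass.
have := atan_ltpi2 ((t - s) / h); have := atan_gtNpi2 ((t' - s) / h).
move: (atan _) (atan _) pi => u v w; lra.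
Qed.

(** The function f(t) = W(x, zbar) J W(t, z)^* J W(t, z) runs from W(x, zbar) at t = a to W(x, z) at
    t = x, and its derivative is the Poisson kernel times [density]. The constant part of the
    deviation meets a total mass of at most 2 pi; the quadratic part meets (t - s)^2 times the
    kernel, which never exceeds 2 h. *)
Lemma jump_poisson h A B : 0 < h -> 0 <= A -> 0 <= B ->
  (forall t, a <= t <= x -> mxl1 (density h t - density h s) <= A + B * (t - s) ^+ 2) ->
  mxl1 (W (s +i* h) x - W (s +i* (- h)) x
    - (poisson_mass h x - poisson_mass h a)%:C *: density h s) <=
  2 * pi * A + 2 * h * B * L.
Proof.
move=> h0 A0 B0 hP; have hn0 : h != 0 by rewrite gt_eqF.
have hnN : - h != 0 by rewrite oppr_eq0.
have [Wa dW] := hW s hn0.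
have dWx : mxderiv a x (W (s +i* h)) _ := mxderivW (lexx _) xb dW.
pose f t := W (s +i* (- h)) x *m (J *m ((W (s +i* h) t)^t* *m (J *m W (s +i* h) t))).
pose p t := 2 * h / ((t - s) ^+ 2 + h ^+ 2).
have p0 t : 0 < (t - s) ^+ 2 + h ^+ 2 by rewrite ltr_wpDl ?sqr_ge0// exprn_gt0.
have df : mxderiv a x f (fun t => (p t)%:C *: density h t).
  have := mxderivMl (W (s +i* (- h)) x) (mxderivMl J (mxderiv_form dWx dWx)).
  apply: eq_mxderiv => // t _; rewrite conj_add_cauchy_coef -!scalemxAr.
  congr (_ *: _).
  rewrite /density /vsol /mirror /Winv /usol opprK !adjmxM adjmxK Jadj !mulmxA.
  by rewrite JJ mul1mx.
have fa : f a = W (s +i* (- h)) x.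
  by rewrite /f Wa adjmx1 mulmx1 mul1mx JJ mulmx1.
have fx : f x = W (s +i* h) x.
  rewrite /f !mulmxA.
  have := WWinv s hnN xab; rewrite /Winv opprK !mulmxA => ->.
  by rewrite mul1mx.
pose g t := A * poisson_mass h t + 2 * h * B * t.
have := @mxderiv_le _ _ _ a x (fun t => f t - (poisson_mass h t)%:C *: density h s)
  (fun t => (p t)%:C *: density h t - (p t)%:C *: density h s) g
  (fun t => A * p t + 2 * h * B) ax.
have -> : f x - (poisson_mass h x)%:C *: density h s - (f a - (poisson_mass h a)%:C *: density h s)
   = W (s +i* h) x - W (s +i* (- h)) x
    - (poisson_mass h x - poisson_mass h a)%:C *: density h s.
  rewrite fx fa rmorphB /= scalerBl; move: (_ *: density h s) => X.
  move: (_ *: density h s) => Y.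
  by apply/matrixP => i j; rewrite !mxE; ring.
move=> hh; apply: le_trans (hh _ _ _) _.
- apply: mxderivB df _; apply: mxderiv_scale => t _.
  exact: is_derive_poisson_mass.
- move=> t _; apply: is_deriveD; last exact: is_derive_cmul.
  have := is_deriveZ A (is_derive_poisson_mass t h0).
  by [].
- move=> t tax; rewrite -scalerBr mxl1Z normc_real ger0_norm; last first.
    by rewrite divr_ge0 ?mulr_ge0 ?(ltW h0)// ltW.
  have pp : 0 <= p t by rewrite divr_ge0 ?mulr_ge0 ?(ltW h0)// ltW.
  apply: le_trans (ler_wpM2l pp (hP t tax)) _.
  rewrite mulrDr [p t * A]mulrC lerD2l mulrCA.
  have -> : 2 * h * B = B * (2 * h) by rewrite mulrC.
  rewrite ler_wpM2l// /p mulrAC -mulrA ler_piMr ?mulr_ge0 ?(ltW h0)//.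
  by rewrite ler_pdivrMr// mul1r lerDl sqr_ge0.
have -> : g x - g a = A * (poisson_mass h x - poisson_mass h a) + 2 * h * B * (x - a).
  by rewrite /g; ring.
rewrite [2 * pi * A]mulrC; apply: lerD; apply: ler_wpM2l => //.
- exact: poisson_mass_le.
- by rewrite !mulr_ge0// ltW.
Qed.

Lemma modulus_small e : 0 < e -> exists2 th, 0 < th & modulus th <= e.
Proof.
move=> e0; set c := (G + 2 * M) * C.
have c0 : 0 <= c by rewrite mulr_ge0// addr_ge0// mulr_ge0// ltW.
have c10 : 0 <= 1 + c by rewrite addr_ge0.
have [h0 /andP[h00 h01] hh] := sqrt_lg4_small L0 c10 e0.
exists h0 => //; have := hh h0; rewrite h00 lexx => /(_ isT) /(le_trans _); apply.
have y1 := ylog_ge1 h00; rewrite -/(ylog h0) in hh *.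
have s1 : h0 <= Num.sqrt h0.
  rewrite -{1}(sqr_sqrtr (ltW h00)) expr2 ler_piMr ?sqrtr_ge0//.
  by rewrite -sqrtr1 ler_wsqrtr.
rewrite /modulus -/c.
have y0 : 0 <= ylog h0 by rewrite (le_trans _ y1).
have y4 : ylog h0 <= ylog h0 ^+ 4 by rewrite ler_eXnr.
apply: le_trans (_ : h0 * ((1 + c) * ylog h0) <= _).
  rewrite ler_wpM2l ?(ltW h00)//.
  have -> : lg L h0 = ylog h0 - 1 by rewrite /ylog addrAC subrr add0r.
  rewrite -subr_ge0.
  have -> : (1 + c) * ylog h0 - (1 + c * (ylog h0 - 1)) = ylog h0 - 1 + c by ring.
  by rewrite addr_ge0// subr_ge0.
rewrite mulrCA ler_wpM2l//; apply: ler_pM => //; exact: ltW.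
Qed.

Lemma modulus_ge0 th : 0 < th -> 0 <= modulus th.
Proof.
move=> th0; rewrite mulr_ge0 ?(ltW th0)// addr_ge0//.
by rewrite !mulr_ge0 ?lg_ge0// addr_ge0// mulr_ge0// ltW.
Qed.

Lemma jump_asymptotics e : 0 < e -> exists2 h0, 0 < h0 & forall h, 0 < h < h0 ->
  mxl1 (W (s +i* h) x - W (s +i* (- h)) x
    - (poisson_mass h x - poisson_mass h a)%:C *: density h s) <= e.
Proof.
move=> e0; set c := 2 * mxl1 J * C.
have c0 : 0 <= c by rewrite !mulr_ge0 ?mxl1_ge0.
have pi0 : 0 < pi :> R := pi_gt0 R.
(* Dominates both [2 * pi * c] and [2 * c * L], the factors of the two contributions in
   [jump_poisson]; the 1 makes it positive. *)
set N := 2 * pi * c + 2 * c * L + 1.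
have pi20 : 0 <= 2 * pi :> R by rewrite mulr_ge0// ltW.
have N0 : 0 < N by rewrite ltr_wpDl// addr_ge0// mulr_ge0// mulr_ge0.
have [th th0 thE] := @modulus_small (e / (4 * N)) ltac:(by rewrite divr_gt0// mulr_gt0).
have th10 : 0 < 2 * G + 1 by rewrite ltr_wpDl// mulr_ge0.
set mu1 := modulus (2 * G + 1).
have mu10 : 0 <= mu1 by exact: modulus_ge0.
have [d d0 hd] := gc sab th0.
have K0 : 0 <= 2 * N * modulus_const by rewrite !mulr_ge0 ?modulus_const_ge0// ltW.
have [h1 /andP[h10 h11] hh1] := sqrt_lg4_small L0 K0 (ltac:(by rewrite divr_gt0) : 0 < e / 4).
set E := N * (mu1 / d ^+ 2) + 1.
have E0 : 0 < E.
  by rewrite ltr_wpDl// mulr_ge0 ?(ltW N0)// divr_ge0// exprn_ge0// ltW.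
exists (Num.min h1 (e / (4 * E))).
  by rewrite lt_min h10 divr_gt0// mulr_gt0.
move=> h /andP[h0]; rewrite lt_min => /andP[hh1' hE].
have y1 := ylog_ge1 h0.
set Y := modulus_const * ylog h ^+ 4; set r := Num.sqrt h.
have Y0 : 0 <= Y by rewrite mulr_ge0 ?modulus_const_ge0// exprn_ge0// (le_trans _ y1).
have r0 : 0 < r by rewrite sqrtr_gt0.
have rr : r * r = h by rewrite -expr2 sqr_sqrtr// ltW.
(* From |t - s| <= r + (t - s)^2 / r with r = sqrt h: the part [r * Y] is constant, the part [Y / r]
   quadratic and thus multiplied by h. Both end up as sqrt h times log^4. *)
set A := c * (modulus th + r * Y); set B := c * (mu1 / d ^+ 2 + Y / r).
have mth0 := modulus_ge0 th0.
have A0 : 0 <= A by rewrite mulr_ge0// addr_ge0// mulr_ge0// ltW.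
have B0 : 0 <= B.
  rewrite mulr_ge0// addr_ge0// divr_ge0//; last exact: ltW.
  by rewrite exprn_ge0// ltW.
have d2 : 0 < d ^+ 2 by rewrite exprn_gt0.
apply: le_trans (jump_poisson h0 A0 B0 _) _.
  move=> t /[dup] tax /andP[at_ tx].
  have sq : 0 <= (t - s) ^+ 2 by exact: sqr_ge0.
  have tle : `|t - s| <= r + (t - s) ^+ 2 / r.
    have [l1|/ltW l1] := leP `|t - s| r.
      by rewrite (le_trans l1)// lerDl divr_ge0// ltW.
    rewrite -[leLHS]add0r lerD ?(ltW r0)// ler_pdivlMr//.
    by rewrite -real_normK ?num_real// expr2 ler_wpM2l.
  (* Near s continuity of [gamma] allows the small [th]. At distance d or more the crude [2 * G + 1]
     is taken, and 1 <= (t - s)^2 / d^2 moves its modulus into the quadratic part. *)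
  have mth : exists th', [/\ 0 < th', mxl1 (gamma t - gamma s) <= th' &
      modulus th' <= modulus th + mu1 / d ^+ 2 * (t - s) ^+ 2].
    have [l1|l1] := ltP `|t - s| d.
      exists th; split => //.
        by apply: hd => //; rewrite at_ (le_trans tx).
      by rewrite lerDl mulr_ge0// divr_ge0// ltW.
    exists (2 * G + 1); split => //.
      rewrite (le_trans (mxl1B _ _))//.
      have g1 : mxl1 (gamma t) <= G by apply: (kb.1 t _).1; rewrite at_ (le_trans tx).
      have g2 : mxl1 (gamma s) <= G by apply: (kb.1 s _).1.
      by rewrite (le_trans (lerD g1 g2))//; lra.
    rewrite -/mu1 -[leLHS]add0r lerD// mulrAC ler_pdivlMr//.
    rewrite ler_wpM2l// -[leRHS]real_normK ?num_real//.
    by rewrite ler_pXn2r// nnegrE ltW.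
  have [th' [th'0 gth' mth']] := mth.
  apply: le_trans (density_sub h0 tax th'0 gth') _; rewrite -/c -/Y.
  have -> : A + B * (t - s) ^+ 2 =
    c * (modulus th + mu1 / d ^+ 2 * (t - s) ^+ 2 + (r + (t - s) ^+ 2 / r) * Y).
    by rewrite /A /B; ring.
  by rewrite ler_wpM2l// lerD// ler_wpM2r.
have hrY : 2 * N * (r * Y) <= e / 4.
  have := hh1 h; rewrite h0 (ltW hh1') => /(_ isT); rewrite -/(ylog h) -/r.
  by rewrite /Y => /(le_trans _); apply; rewrite le_eqVlt; apply/orP; left; apply/eqP; ring.
have hmu : N * (h * (mu1 / d ^+ 2)) <= e / 4.
  have -> : N * (h * (mu1 / d ^+ 2)) = h * (E - 1) by rewrite /E addrK; ring.
  apply: le_trans (_ : h * E <= _); first by rewrite ler_wpM2l ?(ltW h0)// gerBl.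
  move: hE; rewrite ltr_pdivlMr ?mulr_gt0// => /ltW hE.
  by rewrite ler_pdivlMr//; lra.
have hth : N * modulus th <= e / 4.
  by move: thE; rewrite !ler_pdivlMr ?mulr_gt0//; lra.
have hY : h * (Y / r) = r * Y by rewrite -rr; field; rewrite gt_eqF.
have step : 2 * pi * A + 2 * h * B * L <= N * (modulus th + r * Y) +
   N * (h * (mu1 / d ^+ 2) + r * Y).
  apply: lerD.
    rewrite /A mulrA ler_wpM2r//.
      by rewrite addr_ge0// mulr_ge0// ltW.
    have cL0 : 0 <= 2 * c * L by rewrite mulr_ge0// mulr_ge0.
    by rewrite /N -addrA lerDl addr_ge0.
  have -> : 2 * h * B * L = 2 * c * L * (h * (mu1 / d ^+ 2) + h * (Y / r)).
    by rewrite /B; ring.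
  rewrite hY ler_wpM2r//.
    have m20 : 0 <= mu1 / d ^+ 2 by rewrite divr_ge0// ltW.
    by rewrite addr_ge0// mulr_ge0// ltW.
  by rewrite /N addrAC lerDr addr_ge0// mulr_ge0.
apply: le_trans step _; rewrite !mulrDr.
by move: hrY hmu hth; rewrite -!mulrA; lra.
Qed.

Lemma lg_cauchy_small Kk e : 0 <= Kk -> 0 < e -> exists2 h0, 0 < h0 &
  forall h, 0 < h < h0 -> Kk * (h * lg L h) <= e.
Proof.
move=> Kk0 e0; have [h0 /andP[h00 h01] hh] := sqrt_lg4_small L0 Kk0 e0.
exists h0 => // h /andP[hp hlt]; have := hh h; rewrite hp ltW//.
move=> /(_ isT) /(le_trans _); apply; rewrite ler_wpM2l//.
have y1 := ylog_ge1 hp; have y0 : 0 <= ylog h by rewrite (le_trans _ y1).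
have h1 : h <= 1 by rewrite (le_trans (ltW hlt)).
have s1 : h <= Num.sqrt h.
  rewrite -{1}(sqr_sqrtr (ltW hp)) expr2 ler_piMr ?sqrtr_ge0//.
  by rewrite -sqrtr1 ler_wsqrtr.
apply: ler_pM; rewrite ?lg_ge0 ?(ltW hp)// -/(ylog h).
by apply: le_trans (_ : ylog h <= _); rewrite ?ler_eXnr// lerDr.
Qed.

(** By [solution_cauchy] the values at s for heights h1 <= h2 differ by a multiple of h2 lg L h2,
    with the constant [Kk0] refers to. *)
Lemma usol_cvg : exists l, forall e, 0 < e -> exists2 h0, 0 < h0 &
  forall h, 0 < h < h0 -> mxl1 (usol h s - l) <= e.
Proof.
apply: mxl1_cauchy_cvg => e e0.
have Kk0 : 0 <= 4 * M * C * expR (2 * M * L).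
  by rewrite !mulr_ge0 ?expR_ge0// ltW.
have [h0 h00 hh] := lg_cauchy_small Kk0 e0.
exists h0 => // h1 h2 h10 h12 h20.
have h2p : 0 < h2 by rewrite (lt_le_trans h10).
have := hh h2; rewrite h2p h20 => /(_ isT) /(le_trans _); apply.
have h1n : h1 != 0 by rewrite gt_eqF.
have h2n : h2 != 0 by rewrite gt_eqF.
have gcs : mxcont a s gamma by exact: mxcontW gc.
have kbs : kernel_bound J gamma a s G M by exact: kernel_boundW kb.
have sol h : h != 0 -> normalized_solution J gamma a s (cauchy_coef (s +i* h)) (W (s +i* h)).
  by move=> hn; have [u v] := hW s hn; split => //; exact: mxderivW v.
have cb h : 0 < h -> cauchy_bound a s s h (cauchy_coef (s +i* h)).
  move=> hp; have := @cauchy_coef_bound R a s s h; rewrite gtr0_norm//.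
  by apply; rewrite gt_eqF.
have := solution_cauchy G0 M0 as_ sL h2p gcs kbs (sol _ h1n) (cb _ h10)
  (sol _ h2n) (cb _ h2p) _.
move=> h; apply: le_trans (h _) _.
  move=> r /andP[ar rs]; have := @cauchy_coef_sub R s h1 h2 r h10 h12.
  by rewrite distrC ger0_norm// subr_ge0.
by rewrite le_eqVlt; apply/orP; left; apply/eqP; ring.
Qed.

Lemma vsol_cvg : exists l, forall e, 0 < e -> exists2 h0, 0 < h0 &
  forall h, 0 < h < h0 -> mxl1 (vsol h s - l) <= e.
Proof.
apply: mxl1_cauchy_cvg => e e0.
have Kk0 : 0 <= 4 * M * C * expR (2 * M * L).
  by rewrite !mulr_ge0 ?expR_ge0// ltW.
have [h0 h00 hh] := lg_cauchy_small Kk0 e0.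
exists h0 => // h1 h2 h10 h12 h20.
have h2p : 0 < h2 by rewrite (lt_le_trans h10).
have := hh h2; rewrite h2p h20 => /(_ isT) /(le_trans _); apply.
have h1n : h1 != 0 by rewrite gt_eqF.
have h2n : h2 != 0 by rewrite gt_eqF.
have Nxs : - x <= - s by rewrite lerN2.
have NxsL : - s - - x <= L by rewrite opprK addrC lerB.
have gcs : mxcont (- x) (- s) (fun tau => gamma (- tau)).
  by apply: mxcontW (mxcont_opp gc); rewrite lerN2.
have kbs : kernel_bound J (fun tau => gamma (- tau)) (- x) (- s) G M.
  by apply: kernel_boundW mirror_kernel_bound; rewrite lerN2.
have sol h : h != 0 -> normalized_solution J (fun tau => gamma (- tau)) (- x) (- s)
   (fun tau => - cauchy_coef (s +i* h) (- tau)) (mirror s h x).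
  move=> hn; have [u v] := mirror_solution s hn xab; split => //.
  by apply: mxderivW v; rewrite ?lerN2.
have cb h : 0 < h -> cauchy_bound (- x) (- s) (- s) h
    (fun tau => - cauchy_coef (s +i* h) (- tau)).
  move=> hp; have hn : h != 0 by rewrite gt_eqF.
  have := @mirror_cauchy_bound s h x hn; rewrite gtr0_norm//.
  by apply: cauchy_boundW; rewrite ?lerN2.
have := solution_cauchy G0 M0 Nxs NxsL h2p gcs kbs (sol _ h1n) (cb _ h10)
  (sol _ h2n) (cb _ h2p) _.
rewrite opprK => h; apply: le_trans (h _) _.
  move=> r /andP[ar rs]; have := @cauchy_coef_sub R s h1 h2 (- r) h10 h12.
  have -> : `|- r - s| = - s - r.
    by rewrite addrC ger0_norm// subr_ge0.
  by rewrite -normcN opprB opprK addrC.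
by rewrite le_eqVlt; apply/orP; left; apply/eqP; ring.
Qed.

(** The limit is the limiting Poisson mass of [a, x] times J lv^* lu, built from the limits of
    [vsol] and [usol] at s. In the bound, 2 pi is the mass, each [C] bounds one factor, and 2 adds
    two unit tolerances: one for reaching the limit, one for [jump_asymptotics]. *)
Lemma jump_limit : exists l : 'M[R[i]]_m,
  mxl1 l <= 2 * pi * (mxl1 J * C * C) + 2 /\
  forall e, 0 < e -> exists2 h0, 0 < h0 & forall h, 0 < h < h0 ->
    mxl1 (W (s +i* h) x - W (s +i* (- h)) x - l) <= e.
Proof.
have [lu hlu] := usol_cvg; have [lv hlv] := vsol_cvg.
have [k1 hk1] := atan_scaled_cvg (x - s); have [k2 hk2] := atan_scaled_cvg (a - s).
pose kl := 2 * k1 - 2 * k2; pose l := kl%:C *: (J *m lv^t* *m lu).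
have lim e : 0 < e -> exists2 h0, 0 < h0 & forall h, 0 < h < h0 ->
    mxl1 (W (s +i* h) x - W (s +i* (- h)) x - l) <= e.
  move=> e0; have e40 : 0 < e / 4 by rewrite divr_gt0.
  have j0 := mxl1_ge0 J; have pi0 : 0 < pi :> R := pi_gt0 R.
  (* Collects the coefficients of the common tolerance e / (4 T): the error of the mass, at most 4
     tolerances, meets the bound of [density]; the errors of [vsol] and [usol] carry the limiting
     mass [kl]. The 1 keeps [T] positive. *)
  set T := mxl1 J * C * C * 4 + `|kl| * mxl1 J * C + `|kl| * mxl1 J * mxl1 lv + 1.
  have T0 : 0 < T by rewrite ltr_wpDl// !addr_ge0// !mulr_ge0// mxl1_ge0.
  have d0 : 0 < e / (4 * T) by rewrite divr_gt0// mulr_gt0.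
  have [h1 h10 hh1] := jump_asymptotics e40.
  have [h2 h20 hh2] := hlu _ d0; have [h3 h30 hh3] := hlv _ d0.
  have [h4 h40 hh4] := hk1 _ d0; have [h5 h50 hh5] := hk2 _ d0.
  exists (Num.min h1 (Num.min (Num.min h2 h3) (Num.min h4 h5))).
    by rewrite !lt_min h10 h20 h30 h40 h50.
  move=> h /andP[hp]; rewrite !lt_min => /and3P[l1 /andP[l2 l3] /andP[l4 l5]].
  have {hh1} := hh1 h; rewrite hp l1 => /(_ isT) hh1.
  have {hh2} := hh2 h; rewrite hp l2 => /(_ isT) hh2.
  have {hh3} := hh3 h; rewrite hp l3 => /(_ isT) hh3.
  have {hh4} := hh4 h; rewrite hp l4 => /(_ isT) hh4.
  have {hh5} := hh5 h; rewrite hp l5 => /(_ isT) hh5.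
  set D := W _ _ - W _ _ in hh1 *; set kh := poisson_mass h x - poisson_mass h a in hh1.
  have -> : D - l = (D - kh%:C *: density h s) + (kh - kl)%:C *: density h s
      + kl%:C *: (J *m (vsol h s - lv)^t* *m usol h s + J *m lv^t* *m (usol h s - lu)).
    have <- := form_subl (vsol h s) lv (usol h s) lu.
    exact: decompose_scaled.
  have kk : `|kh - kl| <= 4 * (e / (4 * T)).
    rewrite /kh /kl /poisson_mass.
    have -> : 2 * atan ((x - s) / h) - 2 * atan ((a - s) / h) - (2 * k1 - 2 * k2) =
      2 * (atan ((x - s) / h) - k1) - 2 * (atan ((a - s) / h) - k2) by ring.
    rewrite (le_trans (ler_normB _ _))// !normrM ger0_norm//.
    by move: hh4 hh5; move: `|_| `|_| (e / _) => u v w; lra.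
  have Pb := density_bound hp; have Ub : mxl1 (usol h s) <= C by rewrite usol_bound// as_ lexx.
  have kl0 : 0 <= `|kl| := normr_ge0 kl.
  apply: le_trans (mxl1D _ _) _; apply: le_trans (lerD (mxl1D _ _) (lexx _)) _.
  rewrite !mxl1Z !normc_real.
  have b1 : `|kh - kl| * mxl1 (density h s) <= 4 * (e / (4 * T)) * (mxl1 J * C * C).
    by apply: ler_pM; rewrite ?mxl1_ge0.
  have b2 : mxl1 (J *m (vsol h s - lv)^t* *m usol h s + J *m lv^t* *m (usol h s - lu)) <=
     mxl1 J * (e / (4 * T)) * C + mxl1 J * mxl1 lv * (e / (4 * T)).
    apply: le_trans (mxl1D _ _) _; apply: lerD; apply: le_trans (mxl1_form _ _) _.
      by apply: ler_pM; rewrite ?mulr_ge0 ?mxl1_ge0// ler_wpM2l.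
    by rewrite ler_wpM2l// mulr_ge0// mxl1_ge0.
  apply: le_trans (lerD (lerD hh1 b1) (ler_wpM2l kl0 b2)) _.
  have -> : e / 4 + 4 * (e / (4 * T)) * (mxl1 J * C * C) + `|kl| *
    (mxl1 J * (e / (4 * T)) * C + mxl1 J * mxl1 lv * (e / (4 * T))) =
    e / 4 + (e / (4 * T)) * (T - 1) by rewrite /T; ring.
  have : e / (4 * T) * (T - 1) <= e / (4 * T) * T.
    by rewrite ler_wpM2l ?(ltW d0)// gerBl.
  have -> : e / (4 * T) * T = e / 4 by field; rewrite gt_eqF.
  lra.
exists l; split => //.
(* A single height h, small enough for both estimates with tolerance 1, transfers the bound to the
   limit. *)
have [h1 h10 hh1] := lim _ ltr01; have [h2 h20 hh2] := jump_asymptotics ltr01.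
pose h := Num.min h1 h2 / 2.
have hm : 0 < Num.min h1 h2 by rewrite lt_min h10.
have hp : 0 < h by rewrite divr_gt0.
have hlt : h < Num.min h1 h2 by rewrite ltr_pdivrMr// ltr_pMr// ltr1n.
move: hlt; rewrite lt_min => /andP[l1 l2].
have {hh1} := hh1 h; rewrite hp l1 => /(_ isT) hh1.
have {hh2} := hh2 h; rewrite hp l2 => /(_ isT) hh2.
set D := W _ _ - W _ _ in hh1 hh2; set kh := poisson_mass h x - poisson_mass h a in hh2.
have kh0 : 0 <= kh.
  rewrite subr_ge0 /poisson_mass ler_wpM2l// le_atan//.
  by rewrite ler_wpM2r ?invr_ge0 ?(ltW hp)// lerB.
have kP : mxl1 (kh%:C *: density h s) <= 2 * pi * (mxl1 J * C * C).
  rewrite mxl1Z normc_real ger0_norm//; apply: ler_pM; rewrite ?mxl1_ge0//.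
    exact: poisson_mass_le.
  exact: density_bound.
have t1 := mxl1_le_add l D; rewrite mxl1_sub in t1.
have t2 := mxl1_le_add D (kh%:C *: density h s).
apply: le_trans t1 _; apply: le_trans (lerD t2 hh1) _.
apply: le_trans (lerD (lerD kP hh2) (lexx 1)) _.
by rewrite -addrA lerD2l.
Qed.

End UV.

End Jump.

(** * The Darboux transformation *)

Section BoundedLipschitz.
Context {R : realType}.
Variables (a b : R).
Hypothesis ab : a <= b.

Definition mxbdd p q (F : R -> 'M[R[i]]_(p, q)) :=
  exists C, forall x, a <= x <= b -> mxl1 (F x) <= C.

Definition mxlip p q (F : R -> 'M[R[i]]_(p, q)) :=
  exists2 C, 0 <= C & forall x t, a <= x <= b -> a <= t <= b ->
    mxl1 (F x - F t) <= C * `|x - t|.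

Let aab : a <= a <= b. Proof. by rewrite lexx. Qed.

Lemma mxbddM p q r (F : R -> 'M[R[i]]_(p, q)) (G : R -> 'M[R[i]]_(q, r)) :
  mxbdd F -> mxbdd G -> mxbdd (fun x => F x *m G x).
Proof.
move=> [C hC] [D hD]; exists (C * D) => x xab.
by rewrite (le_trans (mxl1M _ _))// ler_pM ?mxl1_ge0 ?hC ?hD.
Qed.

Lemma mxbddD p q (F G : R -> 'M[R[i]]_(p, q)) :
  mxbdd F -> mxbdd G -> mxbdd (fun x => F x + G x).
Proof.
move=> [C hC] [D hD]; exists (C + D) => x xab.
by rewrite (le_trans (mxl1D _ _))// lerD ?hC ?hD.
Qed.

Lemma mxbddN p q (F : R -> 'M[R[i]]_(p, q)) : mxbdd F -> mxbdd (fun x => - F x).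
Proof. by move=> [C hC]; exists C => x xab; rewrite mxl1N hC. Qed.

Lemma mxbddZ p q c (F : R -> 'M[R[i]]_(p, q)) :
  mxbdd F -> mxbdd (fun x => c *: F x).
Proof.
move=> [C hC]; exists (Normc.normc c * C) => x xab.
by rewrite mxl1Z ler_wpM2l ?normc_ge0 ?hC.
Qed.

Lemma mxbdd_adj p q (F : R -> 'M[R[i]]_(p, q)) :
  mxbdd F -> mxbdd (fun x => (F x)^t*).
Proof. by move=> [C hC]; exists C => x xab; rewrite mxl1_adj hC. Qed.

Lemma mxbdd_cst p q (C : 'M[R[i]]_(p, q)) : mxbdd (fun=> C).
Proof. by exists (mxl1 C). Qed.

Lemma mxcont_bdd p q (F : R -> 'M[R[i]]_(p, q)) : mxcont a b F -> mxbdd F.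
Proof. by move=> /(mxcont_bounded ab) [C _ hC]; exists C. Qed.

Lemma mxlip_cont p q (F : R -> 'M[R[i]]_(p, q)) : mxlip F -> mxcont a b F.
Proof.
move=> [C C0 hC] x xab e e0; have C10 : 0 < C + 1 by rewrite ltr_wpDl.
exists (e / (C + 1)); first by rewrite divr_gt0.
move=> y yab yx; apply: le_trans (hC _ _ yab xab) _.
rewrite ltr_pdivlMr// in yx; apply: le_trans (ltW yx).
by rewrite mulrC ler_wpM2l// lerDl.
Qed.

Lemma mxlip_bdd p q (F : R -> 'M[R[i]]_(p, q)) : mxlip F -> mxbdd F.
Proof. by move=> /mxlip_cont; exact: mxcont_bdd. Qed.

Lemma mxlipM p q r (F : R -> 'M[R[i]]_(p, q)) (G : R -> 'M[R[i]]_(q, r)) :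
  mxlip F -> mxlip G -> mxlip (fun x => F x *m G x).
Proof.
move=> lF lG; have [BF hBF] := mxlip_bdd lF; have [BG hBG] := mxlip_bdd lG.
have [C C0 hC] := lF; have [D D0 hD] := lG.
have BF0 : 0 <= BF by rewrite (le_trans (mxl1_ge0 _) (hBF _ aab)).
have BG0 : 0 <= BG by rewrite (le_trans (mxl1_ge0 _) (hBG _ aab)).
exists (C * BG + BF * D); first by rewrite addr_ge0// mulr_ge0.
move=> x t xab tab.
have -> : F x *m G x - F t *m G t = (F x - F t) *m G x + F t *m (G x - G t).
  by rewrite mulmxBl mulmxBr addrA subrK.
rewrite mulrDl (le_trans (mxl1D _ _))//; apply: lerD; apply: le_trans (mxl1M _ _) _.
  by rewrite mulrAC ler_pM ?mxl1_ge0 ?hC ?hBG.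
by rewrite -mulrA ler_pM ?mxl1_ge0 ?hD ?hBF.
Qed.

Lemma mxlip_adj p q (F : R -> 'M[R[i]]_(p, q)) :
  mxlip F -> mxlip (fun x => (F x)^t*).
Proof.
move=> [C C0 hC]; exists C => // x t xab tab.
by rewrite -adjmxB mxl1_adj hC.
Qed.

Lemma mxlip_cst p q (C : 'M[R[i]]_(p, q)) : mxlip (fun=> C).
Proof. by exists 0 => // x t _ _; rewrite subrr mxl10 mul0r. Qed.

Lemma mxlipZ p q c (F : R -> 'M[R[i]]_(p, q)) :
  mxlip F -> mxlip (fun x => c *: F x).
Proof.
move=> [C C0 hC]; exists (Normc.normc c * C).
  by rewrite mulr_ge0 ?normc_ge0.
by move=> x t xab tab; rewrite -scalerBr mxl1Z -mulrA ler_wpM2l ?normc_ge0 ?hC.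
Qed.

Lemma mxlipB p q (F G : R -> 'M[R[i]]_(p, q)) :
  mxlip F -> mxlip G -> mxlip (fun x => F x - G x).
Proof.
move=> [C C0 hC] [D D0 hD]; exists (C + D); first by rewrite addr_ge0.
move=> x t xab tab.
have -> : F x - G x - (F t - G t) = (F x - F t) - (G x - G t).
  by apply/matrixP => i j; rewrite !mxE; ring.
by rewrite mulrDl (le_trans (mxl1B _ _))// lerD ?hC ?hD.
Qed.

Lemma mxderiv_bdd_lip p q (F F' : R -> 'M[R[i]]_(p, q)) :
  mxderiv a b F F' -> mxbdd F' -> mxlip F.
Proof.
move=> dF [C hC].
exists C; first by rewrite (le_trans (mxl1_ge0 _) (hC _ aab)).
move=> x t /andP[ax xb] /andP[at_ tb].
have [tx|/ltW xt] := leP t x.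
  by rewrite ger0_norm ?subr_ge0//; exact: mxderiv_lip dF hC _ _ at_ tx xb.
rewrite mxl1_sub distrC ger0_norm ?subr_ge0//.
exact: mxderiv_lip dF hC _ _ ax xt tb.
Qed.

(** The difference of inverses is F(x)^-1 (F(x) - F(y)) F(y)^-1. Its last factor is controlled by
    absorption: for F(y) within 1 / (2 (c + 1)) of F(x) its norm is at most 2 c. *)
Lemma mxcont_inv n (F : R -> 'M[R[i]]_n) :
  (forall x, a <= x <= b -> F x \in unitmx) -> mxcont a b F ->
  mxcont a b (fun x => invmx (F x)).
Proof.
move=> Fu Fc x xab e e0.
set c := mxl1 (invmx (F x)); have c0 : 0 <= c by exact: mxl1_ge0.
have c10 : 0 < c + 1 by rewrite ltr_wpDl.
have d10 : 0 < (2 * (c + 1))^-1 by rewrite invr_gt0 mulr_gt0.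
have d20 : 0 < e / (2 * (c + 1) ^+ 2) by rewrite divr_gt0// mulr_gt0// exprn_gt0.
have [d1 d1p hd1] := Fc _ xab _ d10; have [d2 d2p hd2] := Fc _ xab _ d20.
exists (Num.min d1 d2); first by rewrite lt_min d1p.
move=> y yab; rewrite lt_min => /andP[y1 y2].
have {hd1} h1 := hd1 _ yab y1; have {hd2} h2 := hd2 _ yab y2.
have E : invmx (F y) - invmx (F x) = invmx (F x) *m (F x - F y) *m invmx (F y).
  rewrite mulmxBr mulmxBl mulVmx ?Fu// mul1mx -mulmxA mulmxV ?Fu//.
  by rewrite mulmx1.
set g := mxl1 (invmx (F y)); have g0 : 0 <= g by exact: mxl1_ge0.
have le_E : mxl1 (invmx (F y) - invmx (F x)) <= c * mxl1 (F y - F x) * g.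
  rewrite E (mxl1_sub (F y)).
  by do 2 (apply: le_trans (mxl1M _ _) _; apply: ler_pM; rewrite ?mxl1_ge0//).
have gle : g <= 2 * c.
  have : g <= c + c * mxl1 (F y - F x) * g.
    by rewrite (le_trans (mxl1_le_add _ (invmx (F x))))// lerD2l.
  have : c * mxl1 (F y - F x) * g <= g / 2.
    rewrite mulrC ler_wpM2l//.
    apply: le_trans (ler_wpM2l c0 h1) _.
    rewrite invfM mulrCA ler_piMr ?invr_ge0// ler_pdivrMr// mul1r.
    by rewrite lerDl.
  lra.
apply: le_trans le_E _.
apply: le_trans (_ : (c + 1) * (e / (2 * (c + 1) ^+ 2)) * (2 * (c + 1)) <= _).
  apply: ler_pM => //; first by rewrite mulr_ge0// mxl1_ge0.
    by apply: ler_pM; rewrite ?mxl1_ge0// lerDl.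
  by rewrite (le_trans gle)// ler_wpM2l// lerDl.
rewrite le_eqVlt; apply/orP; left; apply/eqP; field.
by rewrite gt_eqF.
Qed.

(** Continuity of the inverse comes first, to bound it on the segment; the same difference formula
    then turns boundedness into a Lipschitz estimate. *)
Lemma mxlip_inv n (F : R -> 'M[R[i]]_n) :
  (forall x, a <= x <= b -> F x \in unitmx) -> mxlip F ->
  mxlip (fun x => invmx (F x)).
Proof.
move=> Fu lF; have [D hD] := mxcont_bdd (mxcont_inv Fu (mxlip_cont lF)).
have [C C0 hC] := lF.
have D0 : 0 <= D by rewrite (le_trans (mxl1_ge0 _) (hD _ aab)).
exists (D * C * D); first by rewrite !mulr_ge0.
move=> x t xab tab.
have -> : invmx (F x) - invmx (F t) = invmx (F t) *m (F t - F x) *m invmx (F x).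
  rewrite mulmxBr mulmxBl mulVmx ?Fu// mul1mx -mulmxA mulmxV ?Fu//.
  by rewrite mulmx1.
rewrite mulrAC; apply: le_trans (mxl1M _ _) _.
apply: ler_pM; rewrite ?mxl1_ge0 ?hD//.
rewrite -mulrA; apply: le_trans (mxl1M _ _) _.
by apply: ler_pM; rewrite ?mxl1_ge0 ?hD// mxl1_sub hC.
Qed.

End BoundedLipschitz.

(** * Algebraic identities behind the Darboux transformation *)

Section MatrixIdentities.
Context {R : realType}.
Variables (m n : nat).
Implicit Types (A Q S T E : 'M[R[i]]_n) (P : 'M[R[i]]_(n, m)) (J : 'M[R[i]]_m).

(** With [A1] and [S1] in the roles of the adjoints of [A] and [S]: the common term [Q] drops out of
    the equation for E = S - S1, which is linear and homogeneous. *)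
Lemma lyapunov_sub A A1 S S1 Q :
  (Q - (A *m S + S *m A1)) - (Q - (S1 *m A1 + A *m S1)) =
  - (A *m (S - S1) + (S - S1) *m A1).
Proof.
rewrite (mulmxBr A S S1) (mulmxBl S S1 A1).
move: (A *m S) (S *m A1) (S1 *m A1) (A *m S1) => a1 a2 a3 a4.
by apply/matrixP => ? ?; rewrite !mxE; ring.
Qed.

(** The derivative of A E A1 when A' = A A, A1' = A1 A1 and E' = - (A E + E A1). *)
Lemma lyapunov_conj A A1 E :
  (A *m A *m E + A *m - (A *m E + E *m A1)) *m A1 + A *m E *m (A1 *m A1) = 0.
Proof.
rewrite mulmxN mulmxDr !mulmxA mulmxDl mulNmx mulmxDl.
move: (A *m A *m E *m A1) (A *m E *m A1 *m A1) => X Y.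
by rewrite opprD addrA subrr add0r addNr.
Qed.

(** With the same A' and A1' and S' = Q - (A S + S A1), the derivative of A S - S A1 is A Q - Q
    A1. *)
Lemma sylvester_deriv A A1 S Q :
  A *m A *m S + A *m (Q - (A *m S + S *m A1))
  - ((Q - (A *m S + S *m A1)) *m A1 + S *m (A1 *m A1))
  - (A *m Q - Q *m A1) = 0.
Proof.
rewrite (mulmxBr A Q) (mulmxDr A) (mulmxBl Q _ A1) (mulmxDl _ _ A1) !mulmxA.
move: (A *m A *m S) (A *m Q) (Q *m A1) (A *m S *m A1) (S *m A1 *m A1).
by move=> *; apply/matrixP => ? ?; rewrite !mxE; ring.
Qed.

Lemma one_sub_mul_one_add (c : R[i]) (X J : 'M[R[i]]_m) (Y : 'M[R[i]]_m) :
  (1%:M - c *: X) *m J *m (1%:M + c *: Y) =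
  J + c *: (J *m Y) - c *: (X *m J) - (c * c) *: (X *m J *m Y).
Proof.
rewrite (mulmxBl 1%:M) mul1mx (mulmxDr (J - _)) mulmx1 (mulmxBl J).
rewrite -(scalemxAl c X J) -(scalemxAr c J Y) -scalemxAr -scalemxAl scalerA.
move: (X *m J) => XJ; move: (J *m Y) (XJ *m Y) => JY XJY.
by apply/matrixP => ? ?; rewrite !mxE; ring.
Qed.

(* [T] and [Ai] stand for the inverses of [S] and [A]. *)
Lemma transfer_unitary A Ai A1 Ai1 S T P J :
  J *m J = 1%:M -> Ai *m A = 1%:M -> A1 *m Ai1 = 1%:M -> T *m S = 1%:M ->
  S *m T = 1%:M -> J^t* = J ->
  A *m S - S *m A1 = 'i%C *: (P *m J *m P^t*) ->
  (1%:M - 'i%C *: (J *m P^t* *m T *m Ai *m P)) *m J *m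
    (1%:M + 'i%C *: (P^t* *m Ai1 *m T *m P *m J)) = J.
Proof.
move=> JJ AiA A1i TS ST Jadj E.
have ii : 'i%C * 'i%C = -1 :> R[i] by rewrite -expr2 sqr_i.
have PJP : P *m J *m P^t* = - ('i%C *: (A *m S - S *m A1)).
  by rewrite E scalerA ii scaleN1r opprK.
(* Between [T *m Ai] and [Ai1 *m T] the identity for P J P^* becomes a difference of [Ai1 *m T] and
   [T *m Ai], so the quadratic term of the product cancels the two linear ones. *)
have key : T *m Ai *m (P *m J *m P^t*) *m Ai1 *m T =
    - ('i%C *: (Ai1 *m T - T *m Ai)).
  rewrite PJP mulmxN -scalemxAr !mulNmx -!scalemxAl; congr (- (_ *: _)).
  rewrite mulmxBr !mulmxBl; congr (_ - _).
    rewrite !mulmxA -(mulmxA T Ai A) AiA mulmx1.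
    by rewrite TS mul1mx.
  rewrite !mulmxA -(mulmxA _ A1 Ai1) A1i mulmx1.
  by rewrite -(mulmxA _ S T) ST mulmx1.
have last : (J *m P^t* *m T *m Ai *m P) *m J *m (P^t* *m Ai1 *m T *m P *m J) =
   - ('i%C *: (J *m P^t* *m (Ai1 *m T) *m P *m J - J *m P^t* *m (T *m Ai) *m P *m J)).
  have -> : (J *m P^t* *m T *m Ai *m P) *m J *m (P^t* *m Ai1 *m T *m P *m J) =
     J *m P^t* *m (T *m Ai *m (P *m J *m P^t*) *m Ai1 *m T) *m P *m J.
    by rewrite !mulmxA.
  rewrite key mulmxN -scalemxAr !mulNmx -!scalemxAl.
  by rewrite mulmxBr !mulmxBl.
rewrite one_sub_mul_one_add last ii scaleN1r opprK !mulmxA.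
move: (J *m P^t* *m Ai1 *m T *m P *m J) (J *m P^t* *m T *m Ai *m P *m J) => U V.
by apply/matrixP => ? ?; rewrite !mxE; ring.
Qed.

End MatrixIdentities.

(** * Conserved identities and regularity along the Darboux flow *)

Section Darboux.
Context {R : realType}.
Variables (m n : nat) (a b : R).
Hypothesis ab : a <= b.

Lemma resolvent_unit (B : 'M[R[i]]_n) (t : R) :
  ~~ eigenvalue B t%:C -> B - (t%:C)%:M \in unitmx.
Proof.
by rewrite /eigenvalue /eigenspace negbK kermx_eq0 row_free_unit.
Qed.

Variable B : 'M[R[i]]_n.
Hypothesis hB : forall t : R, a <= t <= b -> ~~ eigenvalue B t%:C.

Let Bu t : a <= t <= b -> B - (t%:C)%:M \in unitmx.
Proof. by move=> tab; apply: resolvent_unit; exact: hB. Qed.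

Lemma mxlip_char : mxlip a b (fun t : R => B - (t%:C)%:M).
Proof.
apply: mxlipB => //; first exact: mxlip_cst.
exists (mxl1 (1%:M : 'M[R[i]]_n)); first exact: mxl1_ge0.
move=> x t _ _; rewrite -[(x%:C)%:M]scalemx1 -[(t%:C)%:M]scalemx1 -scalerBl.
by rewrite mxl1Z -rmorphB normc_real mulrC.
Qed.

Lemma resolvent_lip : mxlip a b (resolvent B).
Proof. exact: mxlip_inv mxlip_char. Qed.

(** The resolvent identity A(y) - A(x) = (y - x) A(y) A(x), together with continuity of A. *)
Lemma resolvent_deriv :
  mxderiv a b (resolvent B) (fun x => resolvent B x *m resolvent B x).
Proof.
move=> x xab e e0.
set c := mxl1 (resolvent B x) + 1.
have c0 : 0 < c by rewrite ltr_wpDl// mxl1_ge0.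
have [d d0 hd] := mxlip_cont resolvent_lip xab (divr_gt0 e0 c0).
exists d => // y yab yx.
have E : resolvent B y - resolvent B x =
    (y - x)%:C *: (resolvent B y *m resolvent B x).
  have -> : resolvent B y - resolvent B x =
     resolvent B y *m ((B - (x%:C)%:M) - (B - (y%:C)%:M)) *m resolvent B x.
    rewrite mulmxBr mulmxBl -mulmxA mulmxV ?Bu// mulmx1.
    by rewrite mulVmx ?Bu// mul1mx.
  have -> : (B - (x%:C)%:M) - (B - (y%:C)%:M) = ((y - x)%:C)%:M.
    rewrite opprB addrC addrA subrK rmorphB /=.
    by apply/matrixP => i j; rewrite !mxE mulrnBl.
  by rewrite mul_mx_scalar -scalemxAl.
rewrite {1}E -scalerBr -mulmxBl mxl1Z normc_real mulrC ler_wpM2r//.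
apply: le_trans (mxl1M _ _) _.
apply: le_trans (_ : e / c * c <= _); last by rewrite divfK// gt_eqF.
by apply: ler_pM; rewrite ?mxl1_ge0 ?hd// lerDl.
Qed.

Variables (J : 'M[R[i]]_m).
Hypotheses (JJ : J *m J = 1%:M) (Jadj : J^t* = J).
Variables (H : R -> 'M[R[i]]_m) (P : R -> 'M[R[i]]_(n, m)) (S : R -> 'M[R[i]]_n).
Hypothesis Hadj : forall x, a <= x <= b -> (H x)^t* = H x.
Hypothesis Hbdd : mxbdd a b H.
Local Notation A := (resolvent B).
Hypothesis dP : mxderiv a b P (fun x => - ('i%C *: (A x *m P x *m J *m H x))).
Hypothesis dS : mxderiv a b S (fun x =>
  P x *m J *m H x *m J^t* *m (P x)^t* - (A x *m S x + S x *m (A x)^t*)).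

(** Being differentiable, P is continuous and so bounded on the segment; its equation then bounds
    its derivative. *)
Lemma P_lip : mxlip a b P.
Proof.
apply: mxderiv_bdd_lip dP _ => //; apply: mxbddN; apply: mxbddZ.
apply: mxbddM => //; apply: mxbddM; last exact: mxbdd_cst.
apply: mxbddM; first exact: mxlip_bdd resolvent_lip.
exact: mxcont_bdd (mxderiv_cont dP).
Qed.

Lemma S_lip : mxlip a b S.
Proof.
have Ab := mxlip_bdd ab resolvent_lip; have Pb := mxlip_bdd ab P_lip.
have Sb := mxcont_bdd ab (mxderiv_cont dS).
have Jb := mxbdd_cst a b J; have Jtb := mxbdd_cst a b (J^t*).
apply: mxderiv_bdd_lip dS _ => //; apply: mxbddD; last apply: mxbddN.
  apply: mxbddM; last exact: mxbdd_adj.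
  by do 3 (apply: mxbddM => //).
by apply: mxbddD; apply: mxbddM => //; exact: mxbdd_adj.
Qed.

(* [A (S - S^* ) A^*] is constant. *)
Lemma S_adj : S a = (S a)^t* -> forall x, a <= x <= b -> (S x)^t* = S x.
Proof.
move=> Sa x xab.
have dA := resolvent_deriv.
have d := mxderivM (mxderivM dA (mxderivB dS (mxderiv_adj dS))) (mxderiv_adj dA).
have {}d : mxderiv a b (fun x => A x *m (S x - (S x)^t*) *m (A x)^t*) (fun=> 0).
  apply: eq_mxderiv d => // t tab.
  have -> : (P t *m J *m H t *m J^t* *m (P t)^t* -
      (A t *m S t + S t *m (A t)^t*))^t* = P t *m J *m H t *m J^t* *m (P t)^t* -
      ((S t)^t* *m (A t)^t* + A t *m (S t)^t*).
    rewrite adjmxB (adjmxD (A t *m S t)) (adjmxM (A t) (S t)) (adjmxM (S t)) adjmxK.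
    congr (_ - _); rewrite (adjmxM _ ((P t)^t*)) adjmxK.
    rewrite (adjmxM _ (J^t*)) (adjmxM _ (H t)) (adjmxM (P t)) (Hadj tab) adjmxK.
    by rewrite Jadj !mulmxA.
  rewrite (adjmxM (A t) (A t)) lyapunov_sub.
  exact: lyapunov_conj.
have E := mxderiv0_const d xab.
have {}E : A x *m (S x - (S x)^t*) *m (A x)^t* = 0.
  by rewrite E -Sa subrr mulmx0 mul0mx.
have Au : A x \in unitmx by rewrite unitmx_inv Bu.
have Atu : (A x)^t* \in unitmx by rewrite map_unitmx unitmx_tr.
apply/esym/eqP; rewrite -subr_eq0.
have -> : S x - (S x)^t* =
    invmx (A x) *m (A x *m (S x - (S x)^t*) *m (A x)^t*) *m invmx ((A x)^t*).
  by rewrite !mulmxA mulVmx// mul1mx -mulmxA mulmxV// mulmx1.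
by rewrite E mulmx0 mul0mx.
Qed.

(** Both sides have derivative A Q - Q A^* with Q = P J H J P^*; for the right side this uses that H
    is self-adjoint. *)
Lemma darboux_identity :
  A a *m S a - S a *m (A a)^t* = 'i%C *: (P a *m J *m (P a)^t*) ->
  forall x, a <= x <= b ->
  A x *m S x - S x *m (A x)^t* = 'i%C *: (P x *m J *m (P x)^t*).
Proof.
move=> ha x xab; have dA := resolvent_deriv.
have dPJP := mxderivM (mxderivMr J dP) (mxderiv_adj dP).
have dAS := mxderivB (mxderivM dA dS) (mxderivM dS (mxderiv_adj dA)).
have d := mxderivB dAS (mxderivMl ('i%C)%:M dPJP).
have ii : 'i%C * 'i%C = -1 :> R[i] by rewrite -expr2 sqr_i.
have ci : Num.conj ('i%C : R[i]) = - 'i%C.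
  by apply/eqP; rewrite eq_complex /= oppr0 !eqxx.
have {}d : mxderiv a b (fun x => A x *m S x - S x *m (A x)^t* -
    ('i%C)%:M *m (P x *m J *m (P x)^t*)) (fun=> 0).
  apply: eq_mxderiv d => // t tab.
  set Q := P t *m J *m H t *m J^t* *m (P t)^t*.
  have -> : ('i%C)%:M *m (- ('i%C *: (A t *m P t *m J *m H t)) *m J *m (P t)^t* +
      P t *m J *m (- ('i%C *: (A t *m P t *m J *m H t)))^t*) =
      A t *m Q - Q *m (A t)^t*.
    rewrite mul_scalar_mx adjmxN adjmxZ ci scaleNr opprK.
    rewrite !mulNmx -!scalemxAl -scalemxAr -scalerN -scalerDr scalerA ii scaleN1r.
    rewrite opprD opprK; congr (_ - _); first by rewrite /Q Jadj !mulmxA.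
    rewrite (adjmxM _ (H t)) (Hadj tab) (adjmxM _ J) Jadj (adjmxM (A t)).
    by rewrite /Q Jadj !mulmxA.
  by rewrite (adjmxM (A t) (A t)) sylvester_deriv.
have := mxderiv0_const d xab; rewrite mul_scalar_mx ha mul_scalar_mx subrr.
by move/eqP; rewrite subr_eq0 => /eqP.
Qed.

Hypothesis Su : forall x, a <= x <= b -> S x \in unitmx.

Lemma darboux0_unitary :
  S a = (S a)^t* ->
  A a *m S a - S a *m (A a)^t* = 'i%C *: (P a *m J *m (P a)^t*) ->
  forall x, a <= x <= b ->
  darboux0 J A S P x *m J *m (darboux0 J A S P x)^t* = J.
Proof.
move=> Sa ha x xab.
have Au : A x \in unitmx by rewrite unitmx_inv Bu.
have Atu : (A x)^t* \in unitmx by rewrite map_unitmx unitmx_tr.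
have Sx := S_adj Sa xab.
have ci : Num.conj ('i%C : R[i]) = - 'i%C.
  by apply/eqP; rewrite eq_complex /= oppr0 !eqxx.
have -> : (darboux0 J A S P x)^t* =
    1%:M + 'i%C *: ((P x)^t* *m invmx ((A x)^t*) *m invmx (S x) *m P x *m J).
  rewrite /darboux0 adjmxB adjmx1 adjmxZ ci scaleNr opprK.
  rewrite (adjmxM _ (P x)) (adjmxM _ (invmx (A x))) (adjmxM _ (invmx (S x))).
  rewrite (adjmxM J) adjmxK Jadj !adjmxV Sx.
  by rewrite !mulmxA.
apply: (@transfer_unitary _ _ _ (A x) (invmx (A x)) ((A x)^t*) _ (S x)) => //.
- exact: mulVmx.
- exact: mulmxV.
- exact: mulVmx (Su xab).
- exact: mulmxV (Su xab).
- exact: darboux_identity.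
Qed.

Lemma darboux0_lip : mxlip a b (darboux0 J A S P).
Proof.
have Pl := P_lip; apply: mxlipB => //; first exact: mxlip_cst.
apply: mxlipZ; apply: mxlipM => //; apply: mxlipM => //.
  apply: mxlipM => //; last exact: mxlip_inv S_lip.
  by apply: mxlipM; [|exact: mxlip_cst|exact: mxlip_adj].
(* The inverse of the resolvent is [B - x], which is affine in x. *)
have [C C0 hC] := mxlip_char; exists C => // x t xab tab.
by rewrite /resolvent !invmxK hC.
Qed.

End Darboux.

Lemma near0_cvg {R : realType} p q (F : R -> 'M[R[i]]_(p, q)) l :
  (forall e, 0 < e -> exists2 h0, 0 < h0 &
    forall h, 0 < h < h0 -> mxl1 (F h - l) <= e) ->
  F h @[h --> 0^'+] --> l.
Proof. by move=> h; apply/cvg_mxl1P => e /h he; apply/near_right0P. Qed.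

(* The kernel of the transformed square root: w(x) J w(t)^* differs from J by a
   term of order |x - t|. *)
Lemma kernel_darboux {R : realType} k m (a b : R) (J : 'M[R[i]]_m)
    (beta : R -> 'M[R[i]]_(k, m)) (w : R -> 'M[R[i]]_m) (K : R) :
  a <= b -> mxbdd a b beta -> mxlip a b w ->
  (forall x, a <= x <= b -> w x *m J *m (w x)^t* = J) ->
  (forall x t, a <= x <= b -> a <= t <= b ->
    mxl1 (beta x *m J *m (beta t)^t*) <= K * `|x - t|) ->
  exists2 K', 0 < K' & forall x t, a <= x <= b -> a <= t <= b ->
    mxl1 (beta x *m w x *m J *m (beta t *m w t)^t*) <= K' * `|x - t|.
Proof.
move=> ab [Cb hCb] wl wJ hK.
have aab : a <= a <= b by rewrite lexx.
have [Cw hCw] := mxlip_bdd ab wl; have [C C0 hC] := wl.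
have Cb0 : 0 <= Cb := le_trans (mxl1_ge0 _) (hCb _ aab).
have Cw0 : 0 <= Cw := le_trans (mxl1_ge0 _) (hCw _ aab).
have D0 : 0 <= Cb * (Cw * mxl1 J * C) * Cb by rewrite !mulr_ge0 ?mxl1_ge0.
(* [K] comes without a sign, hence its absolute value; the 1 makes the constant positive. *)
exists (`|K| + 1 + Cb * (Cw * mxl1 J * C) * Cb).
  by rewrite ltr_pwDl// ltr_wpDl.
move=> x t xab tab.
have -> : beta x *m w x *m J *m (beta t *m w t)^t* =
    beta x *m J *m (beta t)^t* +
    beta x *m (w x *m J *m (w t - w x)^t*) *m (beta t)^t*.
  have -> : w x *m J *m (w t - w x)^t* = w x *m J *m (w t)^t* - J.
    by rewrite adjmxB (mulmxBr (w x *m J)) wJ.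
  rewrite adjmxM (mulmxBr (beta x)) (mulmxBl _ (beta x *m J)) addrC subrK.
  by rewrite !mulmxA.
apply: le_trans (mxl1D _ _) _.
rewrite mulrDl; apply: lerD.
  apply: le_trans (hK x t xab tab) _; rewrite ler_wpM2r//.
  by rewrite (le_trans (ler_norm K))// lerDl.
have -> : Cb * (Cw * mxl1 J * C) * Cb * `|x - t| =
    Cb * (Cw * mxl1 J * (C * `|t - x|)) * Cb by rewrite distrC; ring.
apply: le_trans (mxl1M _ _) _; apply: ler_pM; rewrite ?mxl1_ge0//; last first.
  by rewrite mxl1_adj hCb.
apply: le_trans (mxl1M _ _) _; apply: ler_pM; rewrite ?mxl1_ge0 ?hCb//.
apply: le_trans (mxl1M _ _) _; apply: ler_pM; rewrite ?mxl1_ge0//; last first.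
  by rewrite mxl1_adj hC.
by apply: le_trans (mxl1M _ _) _; rewrite ler_wpM2r ?mxl1_ge0 ?hCw.
Qed.

Theorem proposition3p6 (R : realType) (k m n : nat)
  (hk : (0 < k)%N) (hm : (0 < m)%N) (hn : (0 < n)%N)
  (a b : R) (hab : a < b)
  (J : 'M[R[i]]_m) (hJadj : J = J^t*) (hJunit : J \in unitmx)
  (hJinv : J = invmx J)
  (beta : R -> 'M[R[i]]_(k, m)) (hbeta : {within `[a, b], continuous beta})
  (H : R -> 'M[R[i]]_m)
  (hH : forall x, a <= x <= b -> H x = (beta x)^t* *m beta x)
  (hbetaJ : forall x, a <= x <= b -> beta x *m J *m (beta x)^t* = 0)
  (M : R) (hM : 0 < M)
  (hbetaM : forall x t, a <= t -> t < x -> x <= b ->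
     opnorm (((x - t)%:C)^-1 *: (beta x *m J *m (beta t)^t*)) <= M)
  (B : 'M[R[i]]_n)
  (hB : forall t : R, a <= t <= b -> ~~ eigenvalue B t%:C)
  (P : R -> 'M[R[i]]_(n, m)) (S : R -> 'M[R[i]]_n)
  (hSa : S a = (S a)^t*)
  (hid : resolvent B a *m S a - S a *m (resolvent B a)^t*
         = 'i%C *: (P a *m J *m (P a)^t*))
  (hP : deriv_on a b P
     (fun x => - ('i%C *: (resolvent B x *m P x *m J *m H x))))
  (hS : deriv_on a b S
     (fun x => P x *m J *m H x *m J^t* *m (P x)^t*
               - (resolvent B x *m S x + S x *m (resolvent B x)^t*)))
  (hSinv : forall x, a <= x <= b -> S x \in unitmx)
  (w0 : R -> 'M[R[i]]_m)
  (hw0 : forall x, a <= x <= b -> w0 x = darboux0 J (resolvent B) S P x)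
  (betat : R -> 'M[R[i]]_(k, m))
  (hbetat : forall x, a <= x <= b -> betat x = beta x *m w0 x)
  (Ht : R -> 'M[R[i]]_m)
  (hHt : forall x, a <= x <= b -> Ht x = (w0 x)^t* *m H x *m w0 x)
  (Wt : R -> R[i] -> 'M[R[i]]_m)
  (hWt : forall z : R[i], (forall t : R, a <= t <= b -> z != t%:C) ->
     is_mult_integral a b J Ht z (fun x => Wt x z)) :
  {within `[a, b], continuous betat} /\
  (forall x, a <= x <= b -> Ht x = (betat x)^t* *m betat x) /\
  (forall x, a <= x <= b -> betat x *m J *m (betat x)^t* = 0) /\
  (exists Mt : R, 0 < Mt /\
     forall x t, a <= t -> t < x -> x <= b ->
       opnorm (((x - t)%:C)^-1 *: (betat x *m J *m (betat t)^t*)) <= Mt) /\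
  (forall x s, a <= s -> s <= x -> x <= b ->
     cvg (jump Wt x s eta @[eta --> 0^'+])) /\
  (exists C : R, forall x s, a <= s -> s <= x -> x <= b ->
     opnorm (lim (jump Wt x s eta @[eta --> 0^'+])) <= C).
Proof.
have ab : a <= b := ltW hab.
have JJ : J *m J = 1%:M by rewrite {1}hJinv mulVmx.
have Jadj : J^t* = J by [].
have betac : mxcont a b beta := (within_continuousP a b beta).1 hbeta.
have betab := mxcont_bdd ab betac.
have Hadj x : a <= x <= b -> (H x)^t* = H x.
  by move=> /hH ->; rewrite adjmxM adjmxK.
have Hb : mxbdd a b H.
  have [C hC] := mxbddM (mxbdd_adj betab) betab.
  by exists C => x xab; rewrite hH// hC.
have dP := deriv_on_mxderiv hP; have dS := deriv_on_mxderiv hS.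
have w0J x : a <= x <= b -> w0 x *m J *m (w0 x)^t* = J.
  move=> xab; rewrite hw0//.
  exact: (darboux0_unitary ab hB JJ Jadj Hadj dP dS hSinv hSa hid).
have w0l : mxlip a b w0.
  have [C C0 hC] := darboux0_lip ab hB (J := J) Hb dP dS hSinv.
  by exists C => // x t xab tab; rewrite !hw0// hC.
(* Passing from [opnorm] to [mxl1] costs [k * k]. The hypothesis covers t < x, its adjoint covers x
   < t, and the vanishing of beta J beta^* covers the diagonal. *)
have ker x t : a <= x <= b -> a <= t <= b ->
    mxl1 (beta x *m J *m (beta t)^t*) <= (k * k)%:R * M * `|x - t|.
  have lt_ker y u : a <= u -> u < y -> y <= b ->
      mxl1 (beta y *m J *m (beta u)^t*) <= (k * k)%:R * M * `|y - u|.
    move=> au uy yb; have uy0 : 0 < y - u by rewrite subr_gt0.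
    have kk0 : 0 <= (k * k)%:R :> R by exact: ler0n.
    have := le_trans (mxl1_le_opnorm _) (ler_wpM2l kk0 (hbetaM y u au uy yb)).
    rewrite mxl1Z Normc.normcV normc_real => h.
    by rewrite -ler_pdivrMr ?normr_gt0 ?gt_eqF// mulrC; exact: h.
  move=> /andP[ax xb] /andP[at_ tb].
  have [xt|tx|->] := ltgtP x t.
  - have -> : beta x *m J *m (beta t)^t* = (beta t *m J *m (beta x)^t*)^t*.
      by rewrite !adjmxM adjmxK Jadj mulmxA.
    by rewrite mxl1_adj distrC lt_ker.
  - exact: lt_ker.
  - by rewrite hbetaJ ?at_// mxl10 subrr normr0 mulr0.
have [K K0 hK] := kernel_darboux ab betab w0l w0J ker.
have {hK} hK x t : a <= x <= b -> a <= t <= b ->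
    mxl1 (betat x *m J *m (betat t)^t*) <= K * `|x - t|.
  by move=> xab tab; rewrite !hbetat// hK.
have betatc : mxcont a b betat.
  have h := mxcontM betac (mxlip_cont w0l).
  move=> x xab e e0; have [d d0 hd] := h x xab e e0.
  by exists d => // y yab yx; rewrite !hbetat// hd.
have HtE x : a <= x <= b -> Ht x = (betat x)^t* *m betat x.
  by move=> xab; rewrite hHt// hbetat// hH// adjmxM !mulmxA.
split; first exact: (within_continuousP a b betat).2.
split=> //; split.
  move=> x xab; apply: mxl1_eq0; apply: le_trans (hK x x xab xab) _.
  by rewrite subrr normr0 mulr0.
split.
  exists K; split=> // x t at_ tx xb.
  have xt0 : 0 < x - t by rewrite subr_gt0.
  apply: le_trans (opnorm_le_mxl1 _) _.
  rewrite mxl1Z Normc.normcV normc_real ler_pdivrMl ?normr_gt0 ?gt_eqF// mulrC.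
  by apply: hK; rewrite ?at_ ?xb ?andbT; lra.
have [G1 G10 hG1] := mxcont_bounded ab betatc.
have G0 : 0 <= G1 + mxl1 J * G1 by rewrite addr_ge0 ?mulr_ge0 ?mxl1_ge0 ?ltW.
have kb : kernel_bound J betat a b (G1 + mxl1 J * G1) K.
  split=> // t tab; split.
    by rewrite (le_trans (hG1 t tab))// lerDl mulr_ge0 ?mxl1_ge0 ?ltW.
  apply: le_trans (mxl1M _ _) _; rewrite mxl1_adj.
  apply: le_trans (_ : mxl1 J * G1 <= _); first by rewrite ler_wpM2l ?mxl1_ge0 ?hG1.
  by rewrite lerDr ltW.
have sol (s sg : R) : sg != 0 -> normalized_solution J betat a b
    (cauchy_coef (s +i* sg)) (fun t => Wt t (s +i* sg)).
  move=> sg0.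
  have [|W1 /deriv_on_mxderiv dW] := hWt (s +i* sg).
    by move=> t _; rewrite eq_complex /= negb_and sg0 orbT.
  split; first exact: W1.
  apply: eq_mxderiv dW => [//|t tab].
  rewrite (HtE t tab) (mulmxA J ((betat t)^t*)) -(mulmxA _ (betat t)).
  exact: erefl.
have jlim s x as_ sx xb :=
  @jump_limit R k m J JJ Jadj betat a b _ K ab G0 K0 betatc kb
    (fun z t => Wt t z) sol s x as_ sx xb.
split=> [x s as_ sx xb|].
  have [l [_ /near0_cvg hl]] := jlim s x as_ sx xb.
  by apply/cvg_ex; exists l.
(* The witness is found by unification with the bound of [jump_limit], in which neither s nor x
   occurs. *)
eexists => x s as_ sx xb.
have [l [hlb /near0_cvg hl]] := jlim s x as_ sx xb.
have -> : lim (jump Wt x s eta @[eta --> 0^'+]) = l by exact/cvg_lim.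
by apply: le_trans (opnorm_le_mxl1 _) _; exact: hlb.
Qed.
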